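(* Let $m$ satisfy the hypotheses of Theorem 7.4, and let $t\mapsto W_m(t)\in\mathcal L(\widetilde{\mathcal S}_1,\widetilde{\mathcal S}_{-1})$ be the derivative of $X_m$ given there. Let $f\in\widetilde{\mathcal S}_1$, and let $Y:[a,b]\to\widetilde{\mathcal S}_{-1}$ be continuous in the strong topology of $\widetilde{\mathcal S}_{-1}$. Then there exists $p\in\mathbb N$ (depending on $f$) such that $t\mapsto Y(t)\otimes(W_m(t)f)$ is a $\Gamma(\mathcal H_{-p})$-valued function on $[a,b]$. Moreover, the integral \[ \int_a^bY(u)\otimes(W_m(u)f)\,du, \] defined as the limit of Riemann sums, exists: the Riemann sums converge in the norm of $\Gamma(\mathcal H_{-p})$.
   Context: Let $(\widetilde h_n)_{n\ge1}$ be the normalized Hermite functions. For $p\in\mathbb Z$, $\mathcal H_p=\{\sum_nf_n\widetilde h_n:\sum_n|f_n|^2(2n)^p<\infty\}$, and $\Gamma(\mathcal H_p)$ is its full Fock space. $\widetilde{\mathcal S}_1=\bigcap_{p\in\mathbb N}\Gamma(\mathcal H_p)$, and $\widetilde{\mathcal S}_{-1}=\bigcup_{p\in\mathbb N}\Gamma(\mathcal H_{-p})$ with the inductive limit (strong) topology. $\otimes$ denotes the tensor (concatenation) product on the full Fock spaces, $(a_1\otimes\cdots\otimes a_n)\otimes(b_1\otimes\cdots\otimes b_k)=a_1\otimes\cdots\otimes a_n\otimes b_1\otimes\cdots\otimes b_k$, extended bilinearly. Hypotheses of Theorem 7.4: $m\ge0$ is measurable with $\int\frac{m(u)}{1+u^2}du<\infty$,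 and $m(u)\le K|u|^{-b}$ for $|u|\le1$ and $m(u)\le K|u|^{2N}$ for $|u|>1$, where $b<2$, $N\in\mathbb N_0$, $K<\infty$. Define $X_m(t)=\ell_{T_m1_{[0,t]}}+\ell^*_{T_m1_{[0,t]}}$, where $T_m$ is the Fourier multiplier by $\sqrt m$, $\ell_g$ is creation by $g$, and $\ell_g^*$ is annihilation by $g$. Then $W_m(t)f=\frac{d}{dt}X_m(t)f$ for $f\in\widetilde{\mathcal S}_1$. *)

(* Defs.v *)
From HB Require Import structures.
From mathcomp Require Import all_boot all_order all_algebra.
From mathcomp Require Import all_classical all_reals all_analysis.
From mathcomp Require Import complex.

Set Implicit Arguments.
Unset Strict Implicit.
Unset Printing Implicit Defensive.

Import Order.TTheory GRing.Theory Num.Theory.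
Import numFieldNormedType.Exports.
Local Open Scope classical_set_scope.
Local Open Scope ring_scope.

Section WhiteNoiseDefs.
Variable R : realType.
Local Notation C := R[i].

Definition cre (z : C) : R := let: Complex a _ := z in a.
Definition cim (z : C) : R := let: Complex _ b := z in b.
Definition cabs2 (z : C) : R := cre z ^+ 2 + cim z ^+ 2.
Definition cabs (z : C) : R := Num.sqrt (cabs2 z).
Definition cconj (z : C) : C := (cre z -i* cim z)%C.

Definition Rint (f : R -> R) : R := Rintegral (@lebesgue_measure R) setT f.
Definition Cint (f : R -> C) : C :=
  (Rint (fun x => cre (f x)) +i* Rint (fun x => cim (f x)))%C.

Definition rsum (T : choiceType) (u : T -> R) : R :=
  fine (\esum_(x in [set: T]) (Num.max (u x) 0)%:E)
  - fine (\esum_(x in [set: T]) (Num.max (- u x) 0)%:E).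
Definition csum (T : choiceType) (u : T -> C) : C :=
  (rsum (fun x => cre (u x)) +i* rsum (fun x => cim (u x)))%C.

(* hermP n x = (H_n x, H_(n+1) x), physicists' Hermite polynomials,
   H_0 = 1, H_1 = 2x, H_(n+1) = 2x H_n - 2n H_(n-1). *)
Fixpoint hermP (n : nat) (x : R) : R * R :=
  match n with
  | 0 => (1, 2 * x)
  | n'.+1 => let hp := hermP n' x in
             (hp.2, 2 * x * hp.2 - 2 * (n'.+1)%:R * hp.1)
  end.
(* normalized Hermite function h_n (index from 0):
   h_n(x) = (2^n n! sqrt pi)^(-1/2) H_n(x) exp(-x^2/2).
   The paper's \tilde h_k (k >= 1) is h_(k-1); below, index k : nat of
   the Fock coordinates stands for \tilde h_(k+1) = h_k. *)
Definition herm (n : nat) (x : R) : R :=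
  (hermP n x).1 / Num.sqrt (2 ^+ n * (n`!)%:R * Num.sqrt pi)
  * expR (- (x ^+ 2) / 2).

Definition FTr (f : R -> R) (xi : R) : C :=
  let c := (Num.sqrt (2 * pi))^-1 in
  (c * Rint (fun x => f x * cos (x * xi))
   +i* (- (c * Rint (fun x => f x * sin (x * xi)))))%C.

Definition ind0 (t x : R) : R :=
  if 0 <= t then (if (0 <= x) && (x <= t) then 1 else 0)
  else (if (t <= x) && (x <= 0) then -1 else 0).

(* Hermite coordinates of T_m 1_[0,t]:  <T_m 1_[0,t], \tilde h_(k+1)>
   = \int sqrt(m xi) \hat{1_[0,t]}(xi) conj(\hat{h_k}(xi)) dxi  (Plancherel) *)
Definition gcoef (m : R -> R) (t : R) (k : nat) : C :=
  Cint (fun xi => ((Num.sqrt (m xi))%:C)%C * FTr (ind0 t) xi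
                  * cconj (FTr (herm k) xi)).

(* An element of the full Fock space is given by its coefficients on the
   orthogonal basis \tilde h_(w_1+1) (x) ... (x) \tilde h_(w_n+1),
   w = [:: w_1; ...; w_n] (the empty word is the vacuum). *)
Definition fock := seq nat -> C.

Definition weight (p : int) (w : seq nat) : R :=
  \prod_(k <- w) ((2 * k.+1)%:R ^ p).

Definition fnorm2 (p : int) (F : fock) : \bar R :=
  \esum_(w in [set: seq nat]) (cabs2 (F w) * weight p w)%:E.

Definition inGamma (p : int) (F : fock) : Prop := (fnorm2 p F < +oo)%E.
Definition inS1 (F : fock) : Prop := forall p : nat, inGamma p%:Z F.
Definition inSm1 (F : fock) : Prop := exists p : nat, inGamma (- p%:Z) F.

Definition fadd (F G : fock) : fock := fun w => F w + G w.
Definition fsub (F G : fock) : fock := fun w => F w - G w.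
Definition fscale (c : C) (F : fock) : fock := fun w => c * F w.

Definition ftensor (F G : fock) : fock :=
  fun w => \sum_(i < (size w).+1) F (take i w) * G (drop i w).

(* creation and annihilation by g = sum_k g_k \tilde h_(k+1) *)
Definition creation (g : nat -> C) (F : fock) : fock :=
  fun w => if w is k :: w' then g k * F w' else 0.
Definition annihilation (g : nat -> C) (F : fock) : fock :=
  fun w => csum (fun k : nat => cconj (g k) * F (k :: w)).

Definition Xm (m : R -> R) (t : R) (F : fock) : fock :=
  fadd (creation (gcoef m t) F) (annihilation (gcoef m t) F).

(* basic 0-neighbourhoods of the locally convex inductive limit:
   absolutely convex subsets of \tilde S_{-1} whose trace on every
   Gamma(H_{-p}) contains a norm ball around 0 *)
Definition nbhd0 (U : set fock) : Prop :=
  [/\ (forall F, U F -> inSm1 F),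
      (forall F G (l mu : C), U F -> U G -> cabs l + cabs mu <= 1 ->
          U (fadd (fscale l F) (fscale mu G)))
    & (forall p : nat, exists2 e : R, 0 < e &
          forall F, (fnorm2 (- p%:Z) F < e%:E)%E -> U F)].

Definition Sm1_continuous_on (Y : R -> fock) (a b : R) : Prop :=
  (forall t, a <= t <= b -> inSm1 (Y t)) /\
  (forall t, a <= t <= b -> forall U, nbhd0 U ->
     exists2 d : R, 0 < d &
       forall s, a <= s <= b -> `|s - t| < d -> U (fsub (Y s) (Y t))).

Definition is_Wm (m : R -> R) (W : R -> fock -> fock) : Prop :=
  forall t F, inS1 F ->
    inSm1 (W t F) /\
    (forall U, nbhd0 U -> exists2 d : R, 0 < d &
       forall h : R, 0 < `|h| < d ->
         U (fsub (fscale ((h^-1)%:C)%C (fsub (Xm m (t + h) F) (Xm m t F)))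
                 (W t F))).

Definition riemann_sum (Y : R -> fock) (W : R -> fock -> fock) (f : fock)
  (n : nat) (x s : nat -> R) : fock :=
  fun w => \sum_(i < n) (((x i.+1 - x i)%:C)%C * ftensor (Y (s i)) (W (s i) f) w).

End WhiteNoiseDefs.

(* Main.v *)
(* Write word_size w = prod_i 2(w_i + 1), so that the weight of the p-th norm at
   the word w is word_size w ^ p. Since sum_w word_size w ^ -2 <= 2, an element of
   Sm1 is the same thing as a family of coefficients bounded by M * word_size ^ q
   for some M and q, and convergence in a fixed Gamma(H_{-p}) follows from
   coordinatewise convergence together with a uniform bound of this kind for a
   smaller exponent.

   On the compact [a, b], continuity of Y in the inductive limit yields one such
   bound for all Y t. For W, no formula for the derivative is needed: first and
   second differences of t |-> gcoef m t k are O(|u|) and O(|u| |t - s|), with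
   constants polynomial in k, and these bounds pass to the limit of the difference
   quotients, so every coordinate of t |-> W t f is Lipschitz. The constants are
   obtained from sqrt m <= 1 + m and from decay of the Fourier transforms of the
   Hermite functions, itself a consequence of the polynomial growth in k of the L^1
   norm of h_k and of the ladder relations. The Riemann sums then converge in each
   coordinate, with a uniform bound. *)

Require Import Defs.
From HB Require Import structures.
From mathcomp Require Import all_boot all_order all_algebra.
From mathcomp Require Import all_classical all_reals all_analysis.
From mathcomp Require Import complex.
From mathcomp Require Import measurable_realfun zify ring lra.
Import Order.TTheory GRing.Theory Num.Theory.
Import numFieldNormedType.Exports.
Local Open Scope classical_set_scope.
Local Open Scope ring_scope.

Set Implicit Arguments.
Unset Strict Implicit.
Unset Printing Implicit Defensive.

(** * Weights on words *)

Section Words.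
Variable R : realType.
Implicit Types (w : seq nat) (F G : fock R).

(** The hypotheses on [Y] and [W] are qualitative: continuity refers to all sets [nbhd0] at once,
    and [W] is known only as a limit. Test sets cut out by coordinate inequalities turn both into
    estimates on coefficients. The exponents come from one count. The L^1 norm of h_k costs one
    power of 2(k+1), and each multiplication of its transform by xi costs one more. Three
    multiplications are made: two to reach the weight 1 / (1 + xi^2), one because second differences
    in t bring out a factor |xi|. So [gcoef] grows at most like the fourth power; sixth-power decay
    of [f] then leaves the summable power -2 in the annihilation part, and [W t f] gets exponent 4.
    In the tensor product exponents add, with one more for the number of cuts of a word; call the
    result Q. The final exponent is 2 * Q + 3: squaring doubles Q, two powers make the sum over
    words converge, and the last one makes words of large size uniformly negligible. *)

Definition word_size w : R := \prod_(k <- w) (2 * k.+1)%:R.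

Lemma letter_ge2 (k : nat) : 2 <= (2 * k.+1)%:R :> R.
Proof. by rewrite ler_nat mulnS leq_addr. Qed.

Lemma word_size_cat v w : word_size (v ++ w) = word_size v * word_size w.
Proof. exact: big_cat. Qed.

Lemma word_size_cons k w : word_size (k :: w) = (2 * k.+1)%:R * word_size w.
Proof. exact: big_cons. Qed.

Lemma word_size_ge w : 2 ^+ size w <= word_size w.
Proof.
elim: w => [|k w IH]; first by rewrite /word_size big_nil.
rewrite word_size_cons exprS ler_pM ?letter_ge2 ?exprn_ge0 //.
Qed.

Lemma word_size_ge1 w : 1 <= word_size w.
Proof. by apply: le_trans (word_size_ge w); rewrite exprn_ege1 // ler1n. Qed.

Lemma word_size_gt0 w : 0 < word_size w.
Proof. exact: lt_le_trans ltr01 (word_size_ge1 w). Qed.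

(** This pays for the number of cuts of a word in [ftensor]. Together with [letter_le_word_size] it
    shows that only finitely many words lie below a given size. *)
Lemma word_size_ge_size w : (size w).+1%:R <= word_size w.
Proof.
apply: le_trans (word_size_ge w); rewrite -natrX ler_nat.
exact: ltn_expl.
Qed.

Lemma letter_le_word_size k w : k \in w -> k.+1%:R <= word_size w.
Proof.
elim: w => // l w IH; rewrite inE word_size_cons => /orP[/eqP <-|/IH kw].
  rewrite -[leLHS]mulr1 ler_pM ?word_size_ge1 // ler_nat mulnC.
  by rewrite leq_pmulr.
rewrite -[leLHS]mul1r ler_pM //.
by rewrite ler1n.
Qed.

Lemma weight_pos (p : nat) w : weight R p%:Z w = word_size w ^+ p.
Proof. by rewrite /weight /word_size -prodrXl. Qed.

Lemma weight_neg (p : nat) w : weight R (- p%:Z) w = word_size w ^- p.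
Proof.
rewrite /weight /word_size -prodrXl -prodfV.
by apply: eq_bigr => k _; rewrite -exprnN.
Qed.

(** [\esum] is a supremum of finite sums, so bounds on duplicate-free lists suffice. *)
Lemma esum_le_of_seq (T : choiceType) (u : T -> R) (c : R) :
  (forall s : seq T, uniq s -> \sum_(x <- s) u x <= c) ->
  (\esum_(x in [set: T]) (u x)%:E <= c%:E)%E.
Proof.
move=> uc; apply: ge_ereal_sup => _ [A [finA _] <-].
rewrite (fsbig_finite _ _ finA) sumEFin lee_fin.
by apply: uc; exact: finmap.fset_uniq.
Qed.

Lemma ler_sum_subseq (T : eqType) (u : T -> R) (s t : seq T) :
  (forall x, 0 <= u x) -> uniq s -> {subset s <= t} ->
  \sum_(x <- s) u x <= \sum_(x <- t) u x.
Proof.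
move=> u0; elim: s t => [|x s IH] t /=; first by rewrite big_nil sumr_ge0.
move=> /andP[xs us] st; have xt : x \in t by rewrite st ?mem_head.
rewrite big_cons (perm_big _ (perm_to_rem xt)) big_cons lerD2l; apply: IH => //.
move=> y ys; have := st y; rewrite inE ys orbT => /(_ isT).
rewrite (perm_mem (perm_to_rem xt)) inE => /orP[/eqP yx|//].
by rewrite -yx ys in xs.
Qed.

(** A finite exhaustion: length at most [n], letters below [K]. The recursion on the first letter is
    chosen so that sums over [words] factor. *)
Fixpoint words (K n : nat) : seq (seq nat) :=
  if n is n'.+1 then
    [::] :: [seq k :: w | k <- iota 0 K, w <- words K n']
  else [:: [::]].

Lemma mem_words (K n : nat) w :
  (size w <= n)%N -> (forall k, k \in w -> (k < K)%N) -> w \in words K n.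
Proof.
elim: n w => [|n IH] [|k w] //= sw kK.
rewrite inE /=; apply/allpairsP; exists (k, w); split=> //=.
  by rewrite mem_iota add0n kK ?mem_head.
by apply: IH => // l lw; rewrite kK // inE lw orbT.
Qed.

(** Telescoping: 1 / (4(k+1)^2) is at most 1 / (4(k+1)^2 - 1) = 1 / (4k+2) - 1 / (4k+6). *)
Lemma sum_letter_inv2 (K : nat) :
  \sum_(k <- iota 0 K) (2 * k.+1)%:R ^- 2 <= 2^-1 - (4 * K + 2)%:R^-1 :> R.
Proof.
elim: K => [|K IH]; first by rewrite big_nil muln0 add0n subrr.
rewrite -addn1 iotaD big_cat /= big_seq1 add0n; apply: le_trans (lerD IH (lexx _)) _.
rewrite addn1 (natrD _ (4 * K)) (natrD _ (4 * K.+1)) !natrM -[K.+1%:R]natr1.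
have K0 : 0 <= K%:R :> R by rewrite ler0n.
set z := K%:R in K0 *.
rewrite -subr_ge0.
have -> : 2^-1 - (4 * (z + 1) + 2)^-1 - (2^-1 - (4 * z + 2)^-1 + (2 * (z + 1)) ^- 2)
   = ((4 * z + 2) * (4 * (z + 1) + 2) * (z + 1) ^+ 2)^-1.
  field.
  by rewrite !gt_eqF //; lra.
by rewrite invr_ge0 !mulr_ge0 ?exprn_ge0 //; lra.
Qed.

Lemma sum_letter_inv2_le (K : nat) :
  \sum_(k <- iota 0 K) (2 * k.+1)%:R ^- 2 <= 2^-1 :> R.
Proof.
apply: le_trans (sum_letter_inv2 K) _.
by rewrite gerBl invr_ge0 ler0n.
Qed.

(** Splitting off the first letter gives S_(n+1) <= 1 + S_n / 2, a recursion that preserves the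
    bound 2. *)
Lemma sum_words_le (K n : nat) :
  \sum_(w <- words K n) word_size w ^- 2 <= 2.
Proof.
elim: n => [|n IH] /=; first by rewrite big_seq1 /word_size big_nil; lra.
rewrite big_cons big_allpairs_dep {1}/word_size big_nil expr1n invr1.
under eq_bigr => k _ do under eq_bigr => w _ do rewrite word_size_cons exprMn invfM.
under eq_bigr => k _ do rewrite -mulr_sumr.
rewrite -mulr_suml.
have := ler_pM (sumr_ge0 _ _) (sumr_ge0 _ _) (sum_letter_inv2_le K) IH.
rewrite mulVf // => H; rewrite -[leRHS]/(1 + 1) lerD2l; apply: H => i _.
  by rewrite invr_ge0 exprn_ge0.
by rewrite invr_ge0 exprn_ge0 // ltW // word_size_gt0.
Qed.

Lemma sum_word_size_le (s : seq (seq nat)) : uniq s ->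
  \sum_(w <- s) word_size w ^- 2 <= 2.
Proof.
move=> us; pose n := \max_(w <- s) size w.
pose K := (\max_(w <- s) \max_(k <- w) k).+1.
apply: le_trans (sum_words_le K n); apply: ler_sum_subseq => //.
  by move=> w; rewrite invr_ge0 exprn_ge0 // ltW // word_size_gt0.
move=> w ws; apply: mem_words; first exact: leq_bigmax_seq.
move=> k kw; rewrite ltnS.
apply: (bigmaxn_sup_seq w) => //.
exact: (bigmaxn_sup_seq k).
Qed.

(** The way from coefficients to norms: two powers of [word_size] are given up to sum over all
    words. *)
Lemma fnorm2_le (p : int) F (eta : R) : 0 <= eta ->
  (forall w, cabs2 (F w) * weight R p w <= eta * word_size w ^- 2) ->
  (fnorm2 p F <= (2 * eta)%:E)%E.
Proof.
move=> eta0 Fle; apply: esum_le_of_seq => s us.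
apply: le_trans (ler_sum _ (fun w _ => Fle w)) _.
by rewrite -mulr_sumr mulrC ler_wpM2r // sum_word_size_le.
Qed.

Lemma cabs2_ge0 (z : R[i]) : 0 <= cabs2 z.
Proof. by rewrite addr_ge0 ?sqr_ge0. Qed.

Lemma weight_ge0 (p : int) w : 0 <= weight R p w.
Proof. by apply: prodr_ge0 => k _; rewrite exprz_ge0. Qed.

Lemma fnorm2_lt_coord (p : int) F (e : R) : (fnorm2 p F < e%:E)%E ->
  forall w, cabs2 (F w) * weight R p w < e.
Proof.
move=> Fe w; rewrite -lte_fin; apply: le_lt_trans Fe.
rewrite /fnorm2; apply: esum_ge; exists [set w].
  by split=> //; exact: finite_set1.
by rewrite fsbig_set1.
Qed.

Lemma inGamma_lt (p : int) F : inGamma p F ->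
  exists2 r : R, 0 <= r & (fnorm2 p F < r%:E)%E.
Proof.
rewrite /inGamma => Fp.
have F0 : (0 <= fnorm2 p F)%E.
  by apply: esum_ge0 => w _; rewrite lee_fin mulr_ge0 ?cabs2_ge0 ?weight_ge0.
move: Fp F0; case: (fnorm2 _ _) => // r _ r0; exists (r + 1).
  by rewrite lee_fin in r0; lra.
by rewrite lte_fin; lra.
Qed.

Lemma fnorm2_lt_bound (p : nat) F (e : R) : (fnorm2 (- p%:Z) F < e%:E)%E ->
  forall w, cabs2 (F w) < e * word_size w ^+ p.
Proof.
move=> /fnorm2_lt_coord Fe w.
by rewrite -ltr_pdivrMr ?exprn_gt0 ?word_size_gt0 // -weight_neg.
Qed.

(** * Modulus, real and imaginary parts; coefficient description of the distributions *)

Lemma cabs_normc (z : R[i]) : cabs z = Normc.normc z.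
Proof. by case: z. Qed.

Lemma cabs_ge0 (z : R[i]) : 0 <= cabs z.
Proof. exact: sqrtr_ge0. Qed.

Lemma cabs_sqr (z : R[i]) : cabs z ^+ 2 = cabs2 z.
Proof. by rewrite sqr_sqrtr ?cabs2_ge0. Qed.

Lemma cabs_le_sqr (z : R[i]) (M : R) : 0 <= M ->
  (cabs z <= M) = (cabs2 z <= M ^+ 2).
Proof. by move=> M0; rewrite -cabs_sqr ler_pXn2r // nnegrE cabs_ge0. Qed.

Lemma cabsM (y z : R[i]) : cabs (y * z) = cabs y * cabs z.
Proof. by rewrite !cabs_normc Normc.normcM. Qed.

Lemma cabsD (y z : R[i]) : cabs (y + z) <= cabs y + cabs z.
Proof. by rewrite !cabs_normc le_normcD. Qed.

Lemma cabsN (z : R[i]) : cabs (- z) = cabs z.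
Proof. by rewrite !cabs_normc normcN. Qed.

Lemma cabsB (y z : R[i]) : cabs (y - z) <= cabs y + cabs z.
Proof. by rewrite -(cabsN z) cabsD. Qed.

Lemma cabs_sum (I : Type) (r : seq I) (z : I -> R[i]) :
  cabs (\sum_(i <- r) z i) <= \sum_(i <- r) cabs (z i).
Proof.
elim/big_rec2: _ => [|i a b _ ab]; first by rewrite cabs_normc Normc.normc0.
exact: le_trans (cabsD _ _) (lerD (lexx _) ab).
Qed.

Lemma cabs_real (x : R) : cabs (x%:C)%C = `|x|.
Proof. by rewrite /cabs /cabs2 /= expr0n addr0 sqrtr_sqr. Qed.

Lemma cabs_conj (z : R[i]) : cabs (cconj z) = cabs z.
Proof. by rewrite /cabs /cabs2 /= sqrrN. Qed.

Lemma cre_le_cabs (z : R[i]) : `|cre z| <= cabs z.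
Proof.
by rewrite -[leLHS]sqrtr_sqr ler_wsqrtr // /cabs2 lerDl sqr_ge0.
Qed.

Lemma cim_le_cabs (z : R[i]) : `|cim z| <= cabs z.
Proof.
by rewrite -[leLHS]sqrtr_sqr ler_wsqrtr // /cabs2 lerDr sqr_ge0.
Qed.

Lemma cabs_le_re_im (z : R[i]) : cabs z <= `|cre z| + `|cim z|.
Proof.
rewrite cabs_le_sqr ?addr_ge0 // sqrrD /cabs2 !real_normK ?num_real //.
by rewrite addrAC lerDl mulrn_wge0 // mulr_ge0.
Qed.

Lemma creD (y z : R[i]) : cre (y + z) = cre y + cre z.
Proof. by case: y; case: z. Qed.

Lemma cimD (y z : R[i]) : cim (y + z) = cim y + cim z.
Proof. by case: y; case: z. Qed.

Lemma creN (z : R[i]) : cre (- z) = - cre z.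
Proof. by case: z. Qed.

Lemma cimN (z : R[i]) : cim (- z) = - cim z.
Proof. by case: z. Qed.

Lemma creB (y z : R[i]) : cre (y - z) = cre y - cre z.
Proof. by rewrite creD creN. Qed.

Lemma cimB (y z : R[i]) : cim (y - z) = cim y - cim z.
Proof. by rewrite cimD cimN. Qed.

Lemma creM (y z : R[i]) : cre (y * z) = cre y * cre z - cim y * cim z.
Proof. by case: y; case: z. Qed.

Lemma cimM (y z : R[i]) : cim (y * z) = cre y * cim z + cim y * cre z.
Proof. by case: y; case: z. Qed.

Lemma cre_sum (I : Type) (r : seq I) (z : I -> R[i]) :
  cre (\sum_(i <- r) z i) = \sum_(i <- r) cre (z i).
Proof. by rewrite (big_morph _ creD (erefl : cre 0 = 0)). Qed.

Lemma cim_sum (I : Type) (r : seq I) (z : I -> R[i]) :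
  cim (\sum_(i <- r) z i) = \sum_(i <- r) cim (z i).
Proof. by rewrite (big_morph _ cimD (erefl : cim 0 = 0)). Qed.

(** No square root is taken: r * z <= ((1 + r) * z)^2 as soon as z >= 1, at the price of a larger
    exponent than necessary. *)
Lemma inGamma_bound (p : nat) F : inGamma (- p%:Z) F ->
  exists2 M : R, 0 <= M & forall w, cabs (F w) <= M * word_size w ^+ p.
Proof.
move=> /inGamma_lt [r r0 Fr].
move: Fr => /fnorm2_lt_bound Fr.
exists (1 + r) => [|w]; first lra.
have w1 := word_size_ge1 w; have wp : 1 <= word_size w ^+ p by rewrite exprn_ege1.
rewrite cabs_le_sqr; last by rewrite mulr_ge0; lra.
have /ltW Fw := Fr w; apply: (le_trans Fw); rewrite exprMn.
set z := _ ^+ p in wp *; rewrite [leRHS]mulrA.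
have zz : z <= z ^+ 2 by rewrite expr2 ler_peMl //; lra.
have rr : r <= (1 + r) ^+ 2 by nra.
by rewrite -[in leRHS]mulrA ler_pM //; lra.
Qed.

Lemma inSm1P F : inSm1 F <->
  exists M p, 0 <= M /\ forall w, cabs (F w) <= M * word_size w ^+ p.
Proof.
split=> [[p /inGamma_bound [M M0 FM]]|[M [p [M0 FM]]]]; first by exists M, p.
(* Squaring doubles the exponent, and two more powers pay for the sum over words. *)
exists (2 * p + 2)%N; rewrite /inGamma.
apply: le_lt_trans (_ : _ <= (2 * M ^+ 2)%:E)%E _; last exact: ltry.
apply: fnorm2_le => [|w]; first exact: sqr_ge0.
rewrite weight_neg exprD invfM mulrA ler_wpM2r //.
  by rewrite invr_ge0 exprn_ge0 // ltW // word_size_gt0.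
rewrite ler_pdivrMr ?exprn_gt0 ?word_size_gt0 // mulnC exprM -exprMn.
by rewrite -cabs_le_sqr ?FM // mulr_ge0 // exprn_ge0 // ltW // word_size_gt0.
Qed.

End Words.

(** * The inductive limit topology *)

Section InductiveLimit.
Variable R : realType.
Implicit Types (w : seq nat) (F G : fock R).

(** For each step of the inductive limit, one radius [e] has to serve all the coordinate constraints
    simultaneously; the radius may shrink with [p], which lets the box impose infinitely many
    constraints. *)
Lemma nbhd0_box (v : nat -> seq nat) (B : nat -> R) :
  (forall q, 0 < B q) ->
  (forall p : nat, exists2 e : R, 0 < e &
     forall q, e * word_size R (v q) ^+ p <= B q ^+ 2) ->
  nbhd0 [set F : fock R | inSm1 F /\ forall q, cabs (F (v q)) <= B q].
Proof.
move=> B0 Be; split=> [F []//|F G l mu [SF FB] [SG GB] lmu|p].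
- have l1 : cabs l <= 1 by have := cabs_ge0 mu; lra.
  have mu1 : cabs mu <= 1 by have := cabs_ge0 l; lra.
  split=> [|q]; last first.
    apply: le_trans (cabsD _ _) _; rewrite !cabsM.
    apply: le_trans (lerD (ler_wpM2l (cabs_ge0 l) (FB q))
      (ler_wpM2l (cabs_ge0 mu) (GB q))) _.
    by rewrite -mulrDl -[leRHS]mul1r ler_wpM2r // ltW.
  move: SF SG => /inSm1P [M [p [M0 FM]]] /inSm1P [M' [p' [M'0 GM]]].
  apply/inSm1P; exists (M + M'), (p + p')%N; split=> [|w]; first exact: addr_ge0.
  have w1 := word_size_ge1 R w.
  apply: le_trans (cabsD _ _) _; rewrite !cabsM mulrDl; apply: lerD.
    apply: le_trans (ler_piMl (cabs_ge0 _) l1) _; apply: le_trans (FM w) _.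
    by rewrite ler_wpM2l // ler_weXn2l // leq_addr.
  apply: le_trans (ler_piMl (cabs_ge0 _) mu1) _; apply: le_trans (GM w) _.
  by rewrite ler_wpM2l // ler_weXn2l // leq_addl.
- have [e e0 eB] := Be p; exists e => // F Fe; split=> [|q].
    by exists p; apply: lt_trans Fe _; exact: ltry.
  rewrite cabs_le_sqr ?(ltW (B0 q)) //; apply: le_trans (eB q).
  exact/ltW/fnorm2_lt_bound.
Qed.

(** The constant sequence of constraints: coordinates are continuous on the inductive limit. Every
    coordinatewise limit below is read off from this neighbourhood. *)
Lemma nbhd0_coord w (e : R) : 0 < e ->
  nbhd0 [set F : fock R | inSm1 F /\ forall q : nat, cabs (F w) <= e].
Proof.
move=> e0; apply: (nbhd0_box (v := fun=> w) (B := fun=> e)) => // p.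
have wp := exprn_gt0 p (word_size_gt0 R w).
exists (e ^+ 2 / word_size R w ^+ p); first exact: divr_gt0 (exprn_gt0 2 e0) wp.
by move=> _; rewrite divfK // gt_eqF.
Qed.

Lemma Sm1_continuous_coord (Y : R -> fock R) (a b : R) w :
  Sm1_continuous_on Y a b -> forall t, a <= t <= b -> forall e, 0 < e ->
  exists2 d, 0 < d & forall s, a <= s <= b -> `|s - t| < d ->
    cabs (Y s w - Y t w) <= e.
Proof.
move=> [_ HY] t tab e e0; have [d d0 Yd] := HY t tab _ (nbhd0_coord w e0).
by exists d => // s sab st; case: (Yd s sab st) => _ /(_ 0%N).
Qed.

(** Compactness in sequential form, used for the boundedness of [Y] and again for uniform continuity
    on a segment. *)
Lemma segment_cluster (t : nat -> R) (a b : R) : (forall q, a <= t q <= b) ->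
  exists2 t0, a <= t0 <= b &
    forall d, 0 < d -> forall n, exists2 q, (n <= q)%N & `|t q - t0| < d.
Proof.
move=> tab; have := @segment_compact R a b (t @ \oo) _ _.
case.
  by exists 0%N => // q _ /=; rewrite in_itv /=; exact: tab.
move=> t0 /= [t0ab cl]; exists t0; first by rewrite in_itv in t0ab.
move=> d d0 n.
have [|x [[q /= nq <-]]] := cl [set x | exists2 q, (n <= q)%N & t q = x]
  (ball t0 d) _ (nbhsx_ballx t0 d d0).
  by exists n => // q /= nq; exists q.
by rewrite -ball_normE /= distrC => ?; exists q.
Qed.

(* Regularity of the inductive limit on compact sets: if no single power of
   [word_size] dominated [Y], points [t_q] and words [w_q] with
   [|Y t_q w_q| > q.+1 * word_size w_q ^ q] would exist, and the box
   [|F w_q| <= word_size w_q ^ q] would contradict continuity of [Y] at a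
   cluster point of the [t_q]. *)
Lemma Sm1_continuous_bounded (Y : R -> fock R) (a b : R) :
  Sm1_continuous_on Y a b ->
  exists M q, 0 <= M /\
    forall t, a <= t <= b -> forall w, cabs (Y t w) <= M * word_size R w ^+ q.
Proof.
move=> [YS HY]; apply: contrapT => nY.
have {nY} bad (q : nat) : exists tw : R * seq nat,
    a <= tw.1 <= b /\ q.+1%:R * word_size R tw.2 ^+ q < cabs (Y tw.1 tw.2).
  apply: contrapT => nq; apply: nY; exists q.+1%:R, q; split=> // t tab w.
  rewrite leNgt; apply/negP => lt; apply: nq; by exists (t, w).
have {bad} [tw twP] := choice bad.
pose t q := (tw q).1; pose v q := (tw q).2.
have tab q : a <= t q <= b by case: (twP q).
have [t0 t0ab t0c] := segment_cluster tab.
have [/inSm1P [M [p [M0 YM]]] _] := (YS t0 t0ab, tt).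
pose B q := word_size R (v q) ^+ q.
have v0 q := word_size_gt0 R (v q).
have v1 q := word_size_ge1 R (v q).
have nB : nbhd0 [set F : fock R | inSm1 F /\ forall q, cabs (F (v q)) <= B q].
  apply: nbhd0_box => [q|r]; first by rewrite exprn_gt0.
  (* For q < r the q-th factor alone compensates [word_size ^+ r] and the others are at most 1; for
     q >= r the bound B q ^ 2, of exponent 2q, already dominates. *)
  pose e := \prod_(q < r) (word_size R (v q) ^+ r)^-1.
  exists e => [|q].
    by apply: prodr_gt0 => q _; rewrite invr_gt0 exprn_gt0.
  have le1 (q' : nat) : (word_size R (v q') ^+ r)^-1 <= 1.
    by rewrite invf_le1 ?exprn_gt0 // exprn_ege1.
  have ge0 (q' : nat) : 0 <= (word_size R (v q') ^+ r)^-1.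
    by rewrite invr_ge0 exprn_ge0 // ltW.
  rewrite /B -exprM; have [qr|rq] := ltnP q r.
    apply: (@le_trans _ _ 1); last by rewrite exprn_ege1.
    rewrite -ler_pdivlMr ?exprn_gt0 // div1r /e (bigD1 (Ordinal qr)) //=.
    by rewrite ler_piMr // numdomain.Num.Theory.prodr_ile1 // => i _; rewrite ge0 le1.
  rewrite -[leRHS]mul1r ler_pM //.
  - by rewrite /e prodr_ge0.
  - by rewrite exprn_ge0 // ltW.
  - by rewrite numdomain.Num.Theory.prodr_ile1 // => i _; rewrite ge0 le1.
  - by rewrite ler_weXn2l // mulnC mul2n -addnn (leq_trans rq) ?leq_addr.
have [d d0 Yd] := HY t0 t0ab _ nB.
(* The index is taken beyond both the exponent and the constant bounding [Y t0]: then |Y t_q| <= (1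
   + M) * B q at the word w_q, with M < q, against the choice of w_q. *)
have [q nq tq] := t0c d d0 (p + Num.bound M)%N.
have [_ /(_ q) Yq] := Yd _ (tab q) tq.
have [_] := twP q; rewrite -/(t q) -/(v q) -/(B q) => lt.
have : cabs (Y (t q) (v q)) <= B q + M * B q.
  rewrite -[X in cabs X](subrK (Y t0 (v q))); apply: le_trans (cabsD _ _) _.
  apply: lerD => //; apply: le_trans (YM _) _.
  by rewrite ler_wpM2l // ler_weXn2l // (leq_trans _ nq) // leq_addr.
have Mq : M < q%:R.
  apply: lt_le_trans (_ : (Num.bound M)%:R <= _).
    by have := archi_boundP M0.
  by rewrite ler_nat (leq_trans _ nq) // leq_addl.
have B0 : 0 < B q by rewrite exprn_gt0.
rewrite leNgt => /negP; apply; apply: le_lt_trans lt.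
by rewrite -natr1 mulrDl mul1r addrC lerD2r ler_wpM2r // ltW.
Qed.

End InductiveLimit.

(** * Integrals on the line *)

Section Integrals.
Variable R : realType.
Local Notation mu := (@lebesgue_measure R).
Local Notation Rint := (@Defs.Rint R).
Implicit Types (f g F : R -> R).

Definition integrableR f := mu.-integrable [set: R] (EFin \o f).

Lemma le_integrableR f g : measurable_fun [set: R] f -> integrableR g ->
  (forall x, `|f x| <= g x) -> integrableR f.
Proof.
move=> mf ig fg; apply: le_integrable ig => //; first exact/measurable_EFinP.
by move=> x _; rewrite lee_fin; apply: le_trans (fg x) _; exact: ler_norm.
Qed.

Lemma integrableRD f g : integrableR f -> integrableR g ->
  integrableR (fun x => f x + g x).
Proof. by move=> i j; exact: (integrableD measurableT i j). Qed.

Lemma integrableRB f g : integrableR f -> integrableR g ->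
  integrableR (fun x => f x - g x).
Proof. by move=> i j; exact: (integrableB measurableT i j). Qed.

Lemma integrableRZ (c : R) f : integrableR f -> integrableR (fun x => c * f x).
Proof. by move=> i; exact: (integrableZl measurableT c i). Qed.

Lemma integrableR_abs f : integrableR f -> integrableR (fun x => `|f x|).
Proof. by move=> i; exact: integrable_norm. Qed.

Lemma integrableR_measurable f : integrableR f -> measurable_fun [set: R] f.
Proof. by move=> /measurable_int/measurable_EFinP. Qed.

Lemma RintD f g : integrableR f -> integrableR g ->
  Rint (fun x => f x + g x) = Rint f + Rint g.
Proof. by move=> i j; exact: RintegralD. Qed.

Lemma RintB f g : integrableR f -> integrableR g ->
  Rint (fun x => f x - g x) = Rint f - Rint g.
Proof. by move=> i j; exact: RintegralB. Qed.

Lemma RintZ (c : R) f : integrableR f -> Rint (fun x => c * f x) = c * Rint f.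
Proof. by move=> i; exact: RintegralZl. Qed.

Lemma le_Rint f g : integrableR f -> integrableR g -> (forall x, f x <= g x) ->
  Rint f <= Rint g.
Proof. by move=> i j fg; apply: le_Rintegral => // x _. Qed.

Lemma Rint_ge0 f : (forall x, 0 <= f x) -> 0 <= Rint f.
Proof. by move=> f0; apply: Rintegral_ge0. Qed.

Lemma normr_Rint_le f g : measurable_fun [set: R] f -> integrableR g ->
  (forall x, `|f x| <= g x) -> `|Rint f| <= Rint g.
Proof.
move=> mf ig fg; have iF := le_integrableR mf ig fg.
apply: le_trans (le_normr_Rintegral _ iF) _ => //.
by apply: le_Rint => //; exact: integrableR_abs.
Qed.

(** The universal dominating function of the file. Evenness reduces the integral to the half-line,
    where its value is known. *)
Lemma integrableR_inv_oneDsqr : integrableR (fun x => (1 + x ^+ 2)^-1).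
Proof.
have p0 (x : R) : 0 <= (1 + x ^+ 2)^-1.
  by rewrite invr_ge0 addr_ge0 ?sqr_ge0.
have cf : continuous (fun x : R => (1 + x ^+ 2)^-1).
  exact: continuous_oneDsqrV.
apply/integrableP; split.
  by apply/measurable_EFinP; exact: continuous_measurable_fun.
under eq_integral => x _ do rewrite /= ger0_norm //.
rewrite ge0_symfun_integralT //; last by move=> x; rewrite /= sqrrN.
rewrite -set_itvcy.
by rewrite integral0y_oneDsqr ltry.
Qed.

Lemma Rint_itv_FTC f F (a b : R) : continuous f ->
  (forall x : R, is_derive x 1 F (f x)) -> a <= b ->
  \int[mu]_(x in `[a, b]) f x = F b - F a.
Proof.
move=> cf dF; rewrite le_eqVlt => /predU1P[<-|ab].
  by rewrite set_itv1 Rintegral_set1 subrr.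
have dF1 x : derivable F x 1 by have := dF x; case.
have cF x : {for x, continuous F}.
  by apply: differentiable_continuous; exact/derivable1_diffP.
rewrite /Rintegral (@continuous_FTC2 _ f F) //.
- by apply: continuous_in_subspaceT => x _; exact: cf.
- split=> // [|].
    by apply: cvg_at_right_filter; exact: cF.
  by apply: cvg_at_left_filter; exact: cF.
- by move=> x _; rewrite derive1E; have := dF x; case.
Qed.

(** Over [-n, n] the integral is F n - F (-n), which tends to 0, while dominated convergence sends
    it to the integral over the line. All integrations by parts rest on this. *)
Lemma Rint_derivative_eq0 f F (C : R) : continuous f ->
  (forall x : R, is_derive x 1 F (f x)) ->
  (forall x, `|F x| <= C / (1 + x ^+ 2)) ->
  (forall x, `|f x| <= C / (1 + x ^+ 2)) -> Rint f = 0.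
Proof.
move=> cf dF FC fC.
have mf : measurable_fun [set: R] f by exact: continuous_measurable_fun.
have ig : integrableR (fun x => C / (1 + x ^+ 2)).
  exact: integrableRZ integrableR_inv_oneDsqr.
have iF := le_integrableR mf ig fC.
pose I (n : nat) := `[- n%:R, n%:R]%classic : set R.
have [] := @dominated_convergence _ _ R mu [set: R] measurableT
  (fun n => EFin \o (f \_ (I n))) (EFin \o f) (EFin \o (fun x => C / (1 + x ^+ 2))).
- move=> n; apply/measurable_EFinP; apply/(measurable_restrictT _ _).1 => //.
  - exact: measurable_itv.
  - exact: measurable_funTS.
- exact/measurable_EFinP.
- apply: aeW => x _; apply: cvg_near_cst.
  exists (Num.bound x) => // n /= bn; congr EFin.
  rewrite patchE mem_set // /I /= in_itv /= -ler_norml.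
  apply: le_trans (_ : (Num.bound x)%:R <= _); last by rewrite ler_nat.
  by rewrite ltW // unstable.ltr_norm_bound.
- exact: ig.
- apply: aeW => x n _; rewrite lee_fin patchE; case: ifP => _ //.
  by rewrite normr0; apply: le_trans (fC x).
move=> _ _ cv.
have {cv} cvI : (fun n : nat => F n%:R - F (- n%:R)) @ \oo --> Rint f.
  have -> : (fun n : nat => F n%:R - F (- n%:R)) =
      fine \o (fun n => \int[mu]_x ((EFin \o (f \_ (I n))) x))%E.
    apply/funext => n /=; rewrite -(Rint_itv_FTC cf dF); last first.
      by rewrite -subr_ge0 opprK addr_ge0.
    by rewrite Rintegral_mkcond.
  apply: fine_cvg; rewrite /Defs.Rint /Rintegral fineK //.
  exact: integrable_fin_num.
have C0 : 0 <= C.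
  by have := le_trans (normr_ge0 _) (FC 0); rewrite expr0n addr0 divr1.
have cv0 : (fun n : nat => F n%:R - F (- n%:R)) @ \oo --> 0.
  apply/cvgr0Pnorm_le => e e0; exists (Num.bound (2 * C / e)) => // n /= bn.
  apply: le_trans (ler_normB _ _) _.
  apply: le_trans (lerD (FC _) (FC _)) _; rewrite sqrrN -mulrDl.
  have n0 : 0 < 1 + n%:R ^+ 2 :> R by rewrite ltr_pwDl // sqr_ge0.
  have Cb : 2 * C / e < (Num.bound (2 * C / e))%:R.
    by apply: archi_boundP; rewrite divr_ge0 ?mulr_ge0 // ltW.
  have nb : (Num.bound (2 * C / e))%:R <= n%:R :> R by rewrite ler_nat.
  have {nb} := lt_le_trans Cb nb; rewrite ltr_pdivrMr // => Cn.
  rewrite ler_pdivrMr // (_ : C + C = 2 * C); last by lra.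
  apply: le_trans (ltW Cn) _.
  rewrite mulrC ler_wpM2l // ?ltW //.
  by have := sqr_ge0 (n%:R - 1 : R); have := ler0n R n; set z := n%:R; nra.
exact: (cvg_unique _ cvI cv0).
Qed.

End Integrals.

(** * Hermite functions *)

Section Derivatives.
Variable R : realType.
Implicit Types (f g : R -> R) (x : R).

Lemma is_derive1_mul f g x (df dg : R) :
  is_derive x 1 f df -> is_derive x 1 g dg ->
  is_derive x 1 (fun y => f y * g y) (df * g x + f x * dg).
Proof.
move=> hf hg; apply: (is_derive_eq (is_deriveM hf hg)).
by rewrite /GRing.scale /= addrC mulrC.
Qed.

Lemma is_derive1_add f g x (df dg : R) :
  is_derive x 1 f df -> is_derive x 1 g dg ->
  is_derive x 1 (fun y => f y + g y) (df + dg).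
Proof. by move=> hf hg; exact: is_deriveD. Qed.

Lemma is_derive1_sub f g x (df dg : R) :
  is_derive x 1 f df -> is_derive x 1 g dg ->
  is_derive x 1 (fun y => f y - g y) (df - dg).
Proof. by move=> hf hg; exact: is_deriveB. Qed.

Lemma is_derive1_const (c x : R) : is_derive x 1 (fun=> c) 0.
Proof. exact: is_derive_cst. Qed.

Lemma is_derive1_scale (c : R) f x (df : R) :
  is_derive x 1 f df -> is_derive x 1 (fun y => c * f y) (c * df).
Proof.
move=> hf; apply: (is_derive_eq (is_derive1_mul (is_derive1_const c x) hf)).
by rewrite mul0r add0r.
Qed.

Lemma is_derive1_id x : is_derive x 1 (fun y => y) 1.
Proof. exact: is_derive_id. Qed.

Lemma is_derive1_compose f g x (df dg : R) :
  is_derive (g x) 1 f df -> is_derive x 1 g dg ->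
  is_derive x 1 (fun y => f (g y)) (df * dg).
Proof. exact: is_derive1_comp. Qed.

Lemma is_derive1_continuous f (df : R -> R) :
  (forall x : R, is_derive x 1 f (df x)) -> continuous f.
Proof.
move=> hf x; apply: differentiable_continuous; apply/derivable1_diffP.
by have := hf x; case.
Qed.

Lemma is_derive_sin_scale (xi x : R) :
  is_derive x 1 (fun y => sin (y * xi)) (xi * cos (x * xi)).
Proof.
have hl : is_derive x 1 (fun y => y * xi) xi.
  apply: (is_derive_eq (is_derive1_mul (is_derive1_id x) (is_derive1_const xi x))).
  by rewrite mul1r mulr0 addr0.
apply: (is_derive_eq
  (@is_derive1_compose sin (fun y => y * xi) x _ _ (is_derive_sin _) hl)).
by rewrite mulrC.
Qed.

Lemma is_derive_cos_scale (xi x : R) :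
  is_derive x 1 (fun y => cos (y * xi)) (- (xi * sin (x * xi))).
Proof.
have hl : is_derive x 1 (fun y => y * xi) xi.
  apply: (is_derive_eq (is_derive1_mul (is_derive1_id x) (is_derive1_const xi x))).
  by rewrite mul1r mulr0 addr0.
apply: (is_derive_eq
  (@is_derive1_compose cos (fun y => y * xi) x _ _ (is_derive_cos _) hl)).
by rewrite mulNr mulrC.
Qed.

Lemma lipschitz_of_derive f (df : R -> R) (c : R) :
  (forall x : R, is_derive x 1 f (df x)) -> (forall x, `|df x| <= c) ->
  forall x y, `|f x - f y| <= c * `|x - y|.
Proof.
move=> hf dfc x y; wlog yx : x y / y <= x.
  have [yx|/ltW xy] := leP y x; first exact.
  by move=> /(_ y x xy); rewrite distrC (distrC y).
have [] := MVT_segment yx (fun z _ => hf z).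
  apply: continuous_subspaceT; exact: is_derive1_continuous hf.
by move=> z _ ->; rewrite normrM ler_wpM2r.
Qed.

Lemma cos_lipschitz x y : `|cos x - cos y| <= `|x - y|.
Proof.
rewrite -[leRHS]mul1r.
by apply: lipschitz_of_derive => z; rewrite normrN sin_max.
Qed.

Lemma sin_lipschitz x y : `|sin x - sin y| <= `|x - y|.
Proof.
rewrite -[leRHS]mul1r.
by apply: lipschitz_of_derive => z; exact: cos_max.
Qed.

End Derivatives.

(** * Ladder relations, decay and norms of the Hermite functions *)

Section Hermite.
Variable R : realType.
Local Notation Rint := (@Defs.Rint R).
Local Notation h := (@herm R).
Implicit Types (n : nat) (x xi : R).

(** The coefficient in x h_n and h_n' as combinations of h_(n-1) and h_(n+1). Since [ladder 0] is 0,
    the truncated predecessor [n.-1] does no harm at n = 0. *)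
Definition ladder n : R := Num.sqrt (2 * n%:R).

Lemma ladder_ge0 n : 0 <= ladder n. Proof. exact: sqrtr_ge0. Qed.

Lemma ladder_sqr n : ladder n ^+ 2 = 2 * n%:R.
Proof. by rewrite sqr_sqrtr // mulr_ge0. Qed.

Lemma ladderS_gt0 n : 0 < ladder n.+1.
Proof. by rewrite sqrtr_gt0 mulr_gt0. Qed.

Lemma is_derive_hermP n x :
  is_derive x 1 (fun y => (hermP n y).1) (2 * x * (hermP n x).1 - (hermP n x).2).
Proof.
have d2 (y : R) : is_derive y 1 (fun z : R => 2 * z) 2.
  by apply: (is_derive_eq (is_derive1_scale 2 (is_derive1_id y))); rewrite mulr1.
(* Both components of the pair go into the induction, because [hermP] shifts the pair at each
   step. *)
suff [] : is_derive x 1 (fun y => (hermP n y).1)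
    (2 * x * (hermP n x).1 - (hermP n x).2) /\
  is_derive x 1 (fun y => (hermP n y).2)
    (2 * x * (hermP n x).2 - (hermP n.+1 x).2) by [].
elim: n => [|n [IH1 IH2]] /=; split.
- apply: (is_derive_eq (is_derive1_const 1 x)); ring.
- by apply: (is_derive_eq (d2 x)); ring.
- exact: IH2.
- have := is_derive1_sub (is_derive1_mul (d2 x) IH2)
     (is_derive1_scale (2 * n.+1%:R) IH1).
  by move=> H; apply: (is_derive_eq H) => /=; rewrite -[n.+2%:R]natr1; ring.
Qed.

Lemma herm_norm_gt0 n :
  0 < Num.sqrt (2 ^+ n * (n`!)%:R * Num.sqrt pi) :> R.
Proof.
by rewrite sqrtr_gt0 !mulr_gt0 ?exprn_gt0 ?ltr0n ?fact_gt0 ?sqrtr_gt0 ?pi_gt0.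
Qed.

Lemma herm_normS n :
  Num.sqrt (2 ^+ n.+1 * (n.+1`!)%:R * Num.sqrt pi) =
  ladder n.+1 * Num.sqrt (2 ^+ n * (n`!)%:R * Num.sqrt pi) :> R.
Proof.
rewrite /ladder -sqrtrM ?mulr_ge0 //; congr (Num.sqrt _).
by rewrite exprS factS natrM; ring.
Qed.

Lemma hermPS n x :
  (hermP n x).2 / Num.sqrt (2 ^+ n * (n`!)%:R * Num.sqrt pi)
    * expR (- (x ^+ 2) / 2) = ladder n.+1 * h n.+1 x.
Proof.
rewrite /herm herm_normS /=; field.
by rewrite !gt_eqF ?herm_norm_gt0 ?ladderS_gt0.
Qed.

Lemma herm_rec n x :
  2 * x * h n x = ladder n * h n.-1 x + ladder n.+1 * h n.+1 x.
Proof.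
rewrite -hermPS; case: n => [|n] /=.
  by rewrite /ladder mulr0 sqrtr0 /herm /=; field; rewrite gt_eqF ?herm_norm_gt0.
rewrite /herm /= herm_normS.
have -> : 2 * n.+1%:R = ladder n.+1 ^+ 2 :> R by rewrite ladder_sqr.
by field; rewrite !gt_eqF ?herm_norm_gt0 ?ladderS_gt0.
Qed.

(** The Gaussian factor contributes -x h_n, so the derivative is x h_n - [ladder n.+1] h_(n+1); the
    recurrence then eliminates x. *)
Lemma is_derive_herm n x : is_derive x 1 (h n)
  ((ladder n * h n.-1 x - ladder n.+1 * h n.+1 x) / 2).
Proof.
have dG : is_derive x 1 (fun y : R => expR (- (y ^+ 2) / 2))
    (- x * expR (- (x ^+ 2) / 2)).
  have dq : is_derive x 1 (fun y : R => - (y ^+ 2) / 2) (- x).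
    have := is_derive1_scale (- 2^-1)
      (is_derive1_mul (is_derive1_id x) (is_derive1_id x)).
    under eq_fun do rewrite -expr2 mulNr mulrC -mulNr.
    by move=> H; apply: (is_derive_eq H); field.
  apply: (is_derive_eq (@is_derive1_compose _ expR
    (fun y => - (y ^+ 2) / 2) x _ _ (is_derive_expR _) dq)).
  by rewrite mulrC.
pose N : R := Num.sqrt (2 ^+ n * (n`!)%:R * Num.sqrt pi).
have := is_derive1_mul (is_derive1_scale N^-1 (is_derive_hermP n x)) dG.
under eq_fun do rewrite (mulrC N^-1).
move=> H; apply: (is_derive_eq H).
have -> : ladder n * h n.-1 x = 2 * x * h n x - ladder n.+1 * h n.+1 x.
  by rewrite herm_rec addrK.
rewrite -hermPS -/N /herm -/N; field.
by rewrite gt_eqF ?herm_norm_gt0.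
Qed.

Lemma continuous_herm n : continuous (h n).
Proof. exact: is_derive1_continuous (is_derive_herm n). Qed.

(** The inequality 1 + y <= e^y at y = x^2 / (2j), raised to the power j, for j > 0. *)
Lemma expR_Gauss_decay (j : nat) : exists2 C : R, 0 <= C &
  forall x, (1 + x ^+ 2) ^+ j * expR (- (x ^+ 2) / 2) <= C.
Proof.
case: j => [|j].
  exists 1 => // x; rewrite expr0 mul1r -[leRHS]expR0 ler_expR.
  by have := sqr_ge0 x; lra.
exists ((2 * j.+1%:R) ^+ j.+1) => [|x]; first by rewrite exprn_ge0 ?mulr_ge0.
rewrite mulNr expRN ler_pdivrMr ?expR_gt0 //.
set y := x ^+ 2 / (2 * j.+1%:R).
have j0 : j.+1%:R != 0 :> R by rewrite pnatr_eq0.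
have j1 : 1 <= j.+1%:R :> R by rewrite ler1n.
have -> : x ^+ 2 / 2 = j.+1%:R * y by rewrite /y; field.
rewrite expRM_natl -exprMn ler_pXn2r ?nnegrE; last 3 first.
- by [].
- by rewrite addr_ge0 ?sqr_ge0.
- by rewrite !mulr_ge0 // ltW // expR_gt0.
apply: le_trans (_ : 2 * j.+1%:R * (1 + y) <= _).
  have -> : 2 * j.+1%:R * (1 + y) = 2 * j.+1%:R + x ^+ 2 by rewrite /y; field.
  by rewrite lerD2r; lra.
by rewrite ler_wpM2l ?mulr_ge0 // expR_ge1Dx.
Qed.

(** The exponent [n] is generous: it lets each factor 2x of the recursion be absorbed by one factor
    1 + x^2. *)
Lemma hermP_bound n : exists2 C : R, 0 <= C &
  forall x, `|(hermP n x).1| <= C * (1 + x ^+ 2) ^+ n.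
Proof.
have x1 x : 1 <= 1 + x ^+ 2 by rewrite lerDl sqr_ge0.
have x2 x : `|2 * x| <= 1 + x ^+ 2.
  have := sqr_ge0 (x - 1); have := sqr_ge0 (x + 1).
  by rewrite ler_norml; set z := x; nra.
suff [] : (exists2 C : R, 0 <= C &
    forall x, `|(hermP n x).1| <= C * (1 + x ^+ 2) ^+ n) /\
  (exists2 C : R, 0 <= C &
    forall x, `|(hermP n x).2| <= C * (1 + x ^+ 2) ^+ n.+1) by [].
elim: n => [|n [[C C0 IH1] [D D0 IH2]]] /=; split.
- by exists 1 => // x; rewrite normr1 expr0 mulr1.
- by exists 1 => // x; rewrite mul1r.
- by exists D.
- exists (D + 2 * n.+1%:R * C) => [|x]; first by rewrite addr_ge0 ?mulr_ge0.
  apply: le_trans (ler_normB _ _) _; rewrite [leRHS]mulrDl; apply: lerD.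
    by rewrite exprS mulrCA normrM ler_pM.
  rewrite normrM (ger0_norm (mulr_ge0 _ _)) // -[leRHS]mulrA ler_wpM2l ?mulr_ge0 //.
  apply: le_trans (IH1 x) _; rewrite ler_wpM2l // ler_weXn2l //.
  by rewrite -addn2 leq_addr.
Qed.

Lemma herm_bound n (j : nat) : exists2 C : R, 0 <= C &
  forall x, `|h n x| <= C / (1 + x ^+ 2) ^+ j.
Proof.
have [C C0 HC] := hermP_bound n; have [D D0 HD] := expR_Gauss_decay (n + j).
have N0 := herm_norm_gt0 n; rewrite /herm; set N := Num.sqrt _ in N0 *.
exists (C * D / N) => [|x]; first by rewrite divr_ge0 ?mulr_ge0 // ltW.
have x0 : 0 < 1 + x ^+ 2 by rewrite ltr_pwDl // sqr_ge0.
rewrite ler_pdivlMr ?exprn_gt0 // !normrM normfV (gtr0_norm N0).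
rewrite (gtr0_norm (expR_gt0 _)); set e := expR _; set a := `|_|.
have -> : a / N * e * (1 + x ^+ 2) ^+ j = a * ((1 + x ^+ 2) ^+ j * e) / N by ring.
rewrite ler_pM2r ?invr_gt0 //.
apply: le_trans (ler_wpM2r _ (HC x)) _.
  by rewrite mulr_ge0 ?exprn_ge0 ?(ltW (expR_gt0 _)) // ltW.
by rewrite -mulrA ler_wpM2l // mulrA -exprD.
Qed.

Lemma measurable_herm n : measurable_fun [set: R] (h n).
Proof. by apply: continuous_measurable_fun; exact: continuous_herm. Qed.

Lemma oneDsqr_gt0 x : 0 < 1 + x ^+ 2.
Proof. by rewrite ltr_pwDl // sqr_ge0. Qed.

Lemma normr_le_oneDsqr x : `|x| <= 1 + x ^+ 2.
Proof.
rewrite ler_norml; have := sqr_ge0 (x - 1); have := sqr_ge0 (x + 1).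
by set z := x; nra.
Qed.

(** Polynomial growth against arbitrarily fast decay; integrability of every Hermite integrand, and
    the vanishing of boundary terms, come from here. *)
Lemma mul_herm_bound (g : R -> R) (M : R) (j n : nat) : 0 <= M ->
  (forall x, `|g x| <= M * (1 + x ^+ 2) ^+ j) ->
  exists2 C : R, 0 <= C & forall x, `|g x * h n x| <= C / (1 + x ^+ 2).
Proof.
move=> M0 gM; have [C C0 HC] := herm_bound n j.+1.
exists (M * C) => [|x]; first exact: mulr_ge0.
have x0 := oneDsqr_gt0 x.
rewrite normrM; apply: le_trans (ler_pM _ _ (gM x) (HC x)) _ => //.
rewrite (exprSr (1 + _)) [leLHS](_ : _ = M * C / (1 + x ^+ 2)) //.
have p0 := exprn_gt0 j x0; set p := _ ^+ j in p0 *; field.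
by rewrite !gt_eqF.
Qed.

Lemma integrable_mul_herm (g : R -> R) (M : R) (j n : nat) : 0 <= M ->
  measurable_fun [set: R] g -> (forall x, `|g x| <= M * (1 + x ^+ 2) ^+ j) ->
  integrableR (fun x => g x * h n x).
Proof.
move=> M0 mg gM; have [C C0 HC] := mul_herm_bound n M0 gM.
apply: le_integrableR HC; last exact/integrableRZ/integrableR_inv_oneDsqr.
exact: measurable_funM mg (measurable_herm n).
Qed.

Lemma integrable_trig_herm (g : R -> R) n : continuous g ->
  (forall x, `|g x| <= 1) -> integrableR (fun x => g x * h n x).
Proof.
move=> cg g1; apply: (@integrable_mul_herm g 1 0) => //.
  exact: continuous_measurable_fun.
by move=> x; rewrite expr0 mulr1.
Qed.

Lemma integrable_herm n : integrableR (h n).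
Proof.
rewrite (_ : h n = fun x => cst 1 x * h n x); last first.
  by apply/funext => x; rewrite /= mul1r.
apply: integrable_trig_herm => [|x]; last by rewrite normr1.
exact: cst_continuous.
Qed.

Lemma integrable_id_herm n : integrableR (fun x => x * h n x).
Proof.
apply: (@integrable_mul_herm id 1 1) => // x.
by rewrite expr1 mul1r normr_le_oneDsqr.
Qed.

Lemma integrable_herm_sqr n : integrableR (fun x => h n x ^+ 2).
Proof.
have [C C0 HC] := herm_bound n 0; have := measurable_herm n => mh.
apply: (@integrable_mul_herm (h n) C 0) => // x.
by have := HC x; rewrite expr0 mulr1 divr1.
Qed.

Lemma integrable_id_herm_sqr n : integrableR (fun x => (x * h n x) ^+ 2).
Proof.
have [C C0 HC] := herm_bound n 0; have := measurable_herm n => mh.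
rewrite (_ : (fun x => _) = fun x => (x ^+ 2 * h n x) * h n x); last first.
  by apply/funext => x; rewrite exprMn -mulrA -expr2.
apply: (@integrable_mul_herm _ C 1) => // [|x].
  by apply: measurable_funM => //; exact: measurable_funX.
have := HC x; rewrite expr0 expr1 divr1 => {}HC.
by rewrite normrM mulrC ler_pM // ger0_norm ?sqr_ge0 // lerDr.
Qed.

(* (h_n h_(n+1))' = sqrt(2 (n+1)) (h_n^2 - h_(n+1)^2), so all the Hermite
   functions have the same L^2 norm. *)
Lemma Rint_herm_sqrS n : Rint (fun x => h n.+1 x ^+ 2) = Rint (fun x => h n x ^+ 2).
Proof.
pose f x := ladder n.+1 * (h n x ^+ 2 - h n.+1 x ^+ 2).
have df x : is_derive x 1 (fun y => h n y * h n.+1 y) (f x).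
  apply: (is_derive_eq (is_derive1_mul (is_derive_herm n x) (is_derive_herm n.+1 x))).
  have -> : ladder n * h n.-1 x = 2 * x * h n x - ladder n.+1 * h n.+1 x.
    by rewrite herm_rec addrK.
  have -> : ladder n.+2 * h n.+2 x = 2 * x * h n.+1 x - ladder n.+1 * h n x.
    by rewrite herm_rec addrC addKr.
  by rewrite /f /=; field.
have [A A0 HA] := herm_bound n 0; have [B B0 HB] := herm_bound n.+1 0.
have b1 : forall x, `|h n x| <= A * (1 + x ^+ 2) ^+ 0.
  by move=> x; have := HA x; rewrite expr0 mulr1 divr1.
have b2 : forall x, `|h n.+1 x| <= B * (1 + x ^+ 2) ^+ 0.
  by move=> x; have := HB x; rewrite expr0 mulr1 divr1.
have [C C0 HC] := mul_herm_bound n.+1 A0 b1.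
have [D D0 HD] := mul_herm_bound n A0 b1.
have [E E0 HE] := mul_herm_bound n.+1 B0 b2.
have x0 := oneDsqr_gt0.
have cf : continuous f.
  move=> x; have c1 := @continuous_herm n x; have c2 := @continuous_herm n.+1 x.
  apply: cvgM; first exact: cvg_cst.
  by apply: cvgB; rewrite expr2; apply: cvgM.
have : Rint f = 0.
  apply: (Rint_derivative_eq0 (C := C + ladder n.+1 * (D + E)) cf df) => x.
    apply: le_trans (HC x) _; rewrite ler_pM2r ?invr_gt0 // lerDl.
    by rewrite mulr_ge0 ?ladder_ge0 ?addr_ge0.
  rewrite normrM ger0_norm ?ladder_ge0 // mulrDl -mulrA.
  apply: le_trans (_ : ladder n.+1 * ((D + E) / (1 + x ^+ 2)) <= _).
    rewrite ler_wpM2l ?ladder_ge0 // mulrDl.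
    by apply: le_trans (ler_normB _ _) _; rewrite lerD // expr2.
  by rewrite lerDr divr_ge0 // ltW.
rewrite RintZ; last exact: integrableRB (integrable_herm_sqr _) (integrable_herm_sqr _).
rewrite RintB; try exact: integrable_herm_sqr.
move/eqP; rewrite mulf_eq0 gt_eqF ?ladderS_gt0 //= subr_eq0.
by move/eqP.
Qed.

Lemma Rint_herm_sqr n : Rint (fun x => h n x ^+ 2) = Rint (fun x => h 0 x ^+ 2).
Proof. by elim: n => // n IH; rewrite Rint_herm_sqrS. Qed.

(** With x h_n = (a + b) / 2 from the recurrence and ((a + b) / 2)^2 <= (a^2 + b^2) / 2, the
    coefficients are n and n + 1. The common L^2 norm is never evaluated. *)
Lemma Rint_id_herm_sqr_le n :
  Rint (fun x => (x * h n x) ^+ 2) <= (2 * n.+1)%:R * Rint (fun x => h 0 x ^+ 2).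
Proof.
have i1 m (c : R) : integrableR (fun x => c * h m x ^+ 2).
  exact/integrableRZ/integrable_herm_sqr.
have := @le_Rint R (fun x => (x * h n x) ^+ 2)
  (fun x => n%:R * h n.-1 x ^+ 2 + n.+1%:R * h n.+1 x ^+ 2)
  (integrable_id_herm_sqr n) (integrableRD (i1 _ _) (i1 _ _)).
rewrite RintD // !RintZ; try exact: integrable_herm_sqr.
rewrite !(Rint_herm_sqr _.+1) (Rint_herm_sqr n.-1) -mulrDl => H.
have I0 : 0 <= Rint (fun x => h 0 x ^+ 2) by apply: Rint_ge0 => x; exact: sqr_ge0.
apply: le_trans (H _) _ => [x|]; last first.
  rewrite ler_wpM2r // -natrD ler_nat mulSn mul1n; lia.
have -> : x * h n x = (ladder n * h n.-1 x + ladder n.+1 * h n.+1 x) / 2.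
  by rewrite -herm_rec; field.
have -> : n%:R = ladder n ^+ 2 / 2 :> R by rewrite ladder_sqr; field.
have -> : n.+1%:R = ladder n.+1 ^+ 2 / 2 :> R by rewrite ladder_sqr; field.
have := sqr_ge0 (ladder n * h n.-1 x - ladder n.+1 * h n.+1 x).
by nra.
Qed.

(* AM-GM: |h| <= 1 / (1 + x^2) + (1 + x^2) h^2 *)
Lemma Rint_norm_herm_le : exists2 A : R, 0 <= A &
  forall n, Rint (fun x => `|h n x|) <= A * (2 * n.+1)%:R.
Proof.
set I0 := Rint (fun x => h 0 x ^+ 2).
have I00 : 0 <= I0 by apply: Rint_ge0 => x; exact: sqr_ge0.
pose J := Rint (fun x : R => (1 + x ^+ 2)^-1).
have J0 : 0 <= J by apply: Rint_ge0 => x; rewrite invr_ge0 ltW // oneDsqr_gt0.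
exists (J + 2 * I0) => [|n]; first by rewrite addr_ge0 // mulr_ge0.
have i1 := integrableR_inv_oneDsqr R.
have i2 := integrable_herm_sqr n; have i3 := integrable_id_herm_sqr n.
apply: le_trans (le_Rint (integrableR_abs (integrable_herm n))
  (integrableRD i1 (integrableRD i2 i3)) _) _ => [x /=|].
  have x0 := oneDsqr_gt0 x; have := sqr_ge0 (`|h n x| * (1 + x ^+ 2) - 2^-1).
  have hE : h n x ^+ 2 = `|h n x| ^+ 2 by rewrite real_normK ?num_real.
  rewrite [(x * _) ^+ 2]exprMn hE.
  set z := `|h n x|; set y := 1 + x ^+ 2 in x0 *.
  have -> : z ^+ 2 + x ^+ 2 * z ^+ 2 = y * z ^+ 2 by rewrite /y; ring.
  move=> H; have : 0 <= (z ^+ 2 * y ^+ 2 - z * y + 1) / y.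
    by rewrite divr_ge0 ?ltW //; nra.
  have -> : (z ^+ 2 * y ^+ 2 - z * y + 1) / y = y * z ^+ 2 - z + y^-1.
    by field; rewrite gt_eqF.
  by move=> ?; lra.
rewrite !RintD //; last exact: integrableRD.
have := Rint_id_herm_sqr_le n; rewrite (Rint_herm_sqr n) -/I0 -/J.
by have := letter_ge2 R n; set r := (2 * n.+1)%:R; nra.
Qed.

End Hermite.

(** * Fourier transforms of the Hermite functions *)

Section FourierHermite.
Variable R : realType.
Local Notation Rint := (@Defs.Rint R).
Local Notation h := (@herm R).
Implicit Types (n : nat) (x xi : R) (f g : R -> R).

Lemma continuous_of_lipschitz f (L : R) :
  (forall x y, `|f x - f y| <= L * `|x - y|) -> continuous f.
Proof.
move=> fL x; apply/cvgrPdist_le => e e0.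
have L1 : 0 < `|L| + 1 by rewrite ltr_wpDl.
near=> y; apply: le_trans (fL x y) _.
apply: le_trans (_ : (`|L| + 1) * `|x - y| <= _).
  by rewrite ler_wpM2r //; have := ler_norm L; lra.
rewrite -ler_pdivlMl //; near: y; apply: cvgr_dist_le; first exact: cvg_id.
by rewrite mulr_gt0 // invr_gt0.
Unshelve. all: by end_near.
Qed.

Lemma measurable_mul_dilation f g xi : measurable_fun [set: R] f ->
  continuous g -> measurable_fun [set: R] (fun x => f x * g (x * xi)).
Proof.
move=> mf cg; apply: measurable_funM => //; apply: continuous_measurable_fun.
move=> x; apply: (@continuous_comp _ _ _ (fun x => x * xi) g); last exact: cg.
exact: mulrr_continuous.
Qed.

Lemma integrable_mul_dilation f g xi : integrableR f -> continuous g ->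
  (forall x, `|g x| <= 1) -> integrableR (fun x => f x * g (x * xi)).
Proof.
move=> fi cg g1; apply: (le_integrableR _ (integrableR_abs fi)).
  exact: measurable_mul_dilation (integrableR_measurable fi) cg.
by move=> x; rewrite normrM ler_piMr.
Qed.

(** The transform is Lipschitz, with the L^1 norm of x f(x) as constant. *)
Lemma continuous_Rint_dilation f g : integrableR f ->
  integrableR (fun x => x * f x) -> (forall x, `|g x| <= 1) ->
  (forall x y, `|g x - g y| <= `|x - y|) ->
  continuous (fun xi => Rint (fun x => f x * g (x * xi))).
Proof.
move=> fi xfi g1 gL.
have cg : continuous g.
  by apply: (@continuous_of_lipschitz _ 1) => x y; rewrite mul1r.
apply: (@continuous_of_lipschitz _ (Rint (fun x => `|x * f x|))) => xi eta.
rewrite -RintB; try exact: integrable_mul_dilation.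
rewrite mulrC -RintZ; last exact: integrableR_abs.
apply: normr_Rint_le => [||x].
- by apply: measurable_funB; apply: measurable_mul_dilation => //;
    exact: integrableR_measurable.
- exact/integrableRZ/integrableR_abs.
- rewrite -mulrBr normrM; apply: le_trans (ler_wpM2l _ (gL _ _)) _ => //.
  by rewrite -mulrBr !normrM [leLHS](_ : _ = `|xi - eta| * (`|x| * `|f x|)) //; ring.
Qed.

(** Up to the factor 1 / sqrt(2 pi), the Fourier transform of h_n is [herm_cos n] - i
    [herm_sin n]. *)
Definition herm_cos n xi := Rint (fun x => h n x * cos (x * xi)).
Definition herm_sin n xi := Rint (fun x => h n x * sin (x * xi)).

Lemma integrable_herm_mul g n (K : R) : 0 <= K -> continuous g ->
  (forall x, `|g x| <= K) -> integrableR (fun x => h n x * g x).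
Proof.
move=> K0 cg gK; rewrite (_ : (fun x => _) = fun x => g x * h n x); last first.
  by apply/funext => x; rewrite mulrC.
apply: (@integrable_mul_herm R g K 0) => //; first exact: continuous_measurable_fun.
by move=> x; rewrite expr0 mulr1.
Qed.

(** The decay of h_n removes the boundary terms, and the ladder relation replaces h_n' by its two
    neighbours. *)
Lemma herm_by_parts g dg n (K : R) : 0 <= K ->
  (forall x : R, is_derive x 1 g (dg x)) -> continuous dg ->
  (forall x, `|g x| <= K) -> (forall x, `|dg x| <= K) ->
  Rint (fun x => h n x * dg x) =
    2^-1 * (ladder R n.+1 * Rint (fun x => h n.+1 x * g x)
            - ladder R n * Rint (fun x => h n.-1 x * g x)).
Proof.
move=> K0 dgE cdg gK dgK; have cg := is_derive1_continuous dgE.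
have i1 := integrable_herm_mul n.-1 K0 cg gK.
have i2 := integrable_herm_mul n.+1 K0 cg gK.
have i3 := integrable_herm_mul n K0 cdg dgK.
pose f x := 2^-1 * (ladder R n * (h n.-1 x * g x) - ladder R n.+1 * (h n.+1 x * g x))
  + h n x * dg x.
have df x : is_derive x 1 (fun y => h n y * g y) (f x).
  apply: (is_derive_eq (is_derive1_mul (is_derive_herm n x) (dgE x))).
  by rewrite /f; field.
have bound (u : R -> R) m : (forall x, `|u x| <= K) ->
    exists2 C : R, 0 <= C & forall x, `|h m x * u x| <= C / (1 + x ^+ 2).
  move=> uK; have [|C C0 HC] := @mul_herm_bound R u K 0 m K0.
    by move=> x; rewrite expr0 mulr1.
  by exists C => // x; rewrite mulrC.
have [C0 C00 HC0] := bound g n gK; have [C1 C10 HC1] := bound g n.-1 gK.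
have [C2 C20 HC2] := bound g n.+1 gK; have [C3 C30 HC3] := bound dg n dgK.
have l1 := ladder_ge0 R n; have l2 := ladder_ge0 R n.+1.
pose C := C0 + (2^-1 * (ladder R n * C1 + ladder R n.+1 * C2) + C3).
have cf : continuous f.
  move=> x; have c1 := @continuous_herm R n x; have c2 := @continuous_herm R n.+1 x.
  have c3 := @continuous_herm R n.-1 x; have c4 := cg x; have c5 := cdg x.
  apply: cvgD; last exact: cvgM.
  apply: cvgM; first exact: cvg_cst.
  by apply: cvgB; apply: cvgM; [exact: cvg_cst|exact: cvgM|exact: cvg_cst|exact: cvgM].
have : Rint f = 0.
  apply: (Rint_derivative_eq0 (C := C) cf df) => x; have x0 := oneDsqr_gt0 x.
    apply: le_trans (HC0 x) _; rewrite ler_pM2r ?invr_gt0 // lerDl.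
    by rewrite !(addr_ge0, mulr_ge0).
  apply: le_trans (ler_normD _ _) _; rewrite /C 2!mulrDl.
  apply: le_trans (_ : _ <= 2^-1 * (ladder R n * C1 + ladder R n.+1 * C2) /
    (1 + x ^+ 2) + C3 / (1 + x ^+ 2)) _; last by rewrite lerDr divr_ge0 // ltW.
  apply: lerD => //; rewrite normrM ger0_norm ?invr_ge0 // -mulrA ler_wpM2l ?invr_ge0 //.
  apply: le_trans (ler_normB _ _) _; rewrite mulrDl; apply: lerD.
    by rewrite normrM (ger0_norm l1) -[leRHS]mulrA; exact: ler_wpM2l.
  by rewrite normrM (ger0_norm l2) -[leRHS]mulrA; exact: ler_wpM2l.
rewrite RintD //; last by apply: integrableRZ; apply: integrableRB; exact: integrableRZ.
rewrite RintZ ?RintB ?RintZ //; try exact: integrableRZ.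
  by move/eqP; rewrite addrC addr_eq0 -mulrN opprB => /eqP.
by apply: integrableRB; exact: integrableRZ.
Qed.

(** The factor xi cos(x xi) is the x-derivative of sin(x xi): multiplication by xi becomes a shift
    of the index, at the cost of one ladder coefficient. *)
Lemma herm_cos_mul n xi : xi * herm_cos n xi =
  2^-1 * (ladder R n.+1 * herm_sin n.+1 xi - ladder R n * herm_sin n.-1 xi).
Proof.
have dg x := is_derive_sin_scale xi x.
have cc : continuous (fun x => cos (x * xi)) :=
  is_derive1_continuous (is_derive_cos_scale xi).
have K1 : 0 <= 1 + `|xi| by rewrite addr_ge0.
rewrite -(herm_by_parts n K1 dg) => [|x|x|x].
- rewrite /herm_cos -RintZ; first by congr Defs.Rint; apply/funext => x; ring.
  by apply: (@integrable_herm_mul _ _ 1) => // x; exact: cos_max.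
- by apply: cvgM; [exact: cvg_cst|exact: cc].
- by apply: le_trans (sin_max _) _; rewrite lerDl.
- rewrite normrM; apply: le_trans (ler_piMr _ (cos_max _)) _ => //.
  by rewrite lerDr.
Qed.

Lemma herm_sin_mul n xi : xi * herm_sin n xi =
  2^-1 * (ladder R n * herm_cos n.-1 xi - ladder R n.+1 * herm_cos n.+1 xi).
Proof.
have dg x := is_derive_cos_scale xi x.
have cs : continuous (fun x => sin (x * xi)) :=
  is_derive1_continuous (is_derive_sin_scale xi).
have K1 : 0 <= 1 + `|xi| by rewrite addr_ge0.
rewrite -opprB mulrN -(herm_by_parts n K1 dg) => [|x|x|x].
- rewrite /herm_sin -RintZ; last first.
    by apply: (@integrable_herm_mul _ _ 1) => // x; exact: sin_max.
  rewrite -mulN1r -RintZ; first by congr Defs.Rint; apply/funext => x; ring.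
  apply: (@integrable_herm_mul _ _ `|xi|) => // [x|x].
    by apply: cvgN; apply: cvgM; [exact: cvg_cst|exact: cs].
  by rewrite normrN normrM ler_piMr // sin_max.
- by apply: cvgN; apply: cvgM; [exact: cvg_cst|exact: cs].
- by apply: le_trans (cos_max _) _; rewrite lerDl.
- rewrite normrN normrM; apply: le_trans (ler_piMr _ (sin_max _)) _ => //.
  by rewrite lerDr.
Qed.

Lemma ladder_le n : ladder R n <= (2 * n.+1)%:R /\ ladder R n.+1 <= (2 * n.+1)%:R.
Proof.
have le (m : nat) : (m <= n.+1)%N -> ladder R m <= (2 * n.+1)%:R.
  move=> mn; rewrite -[leRHS]ger0_norm // -sqrtr_sqr ler_wsqrtr //.
  rewrite -natrX -natrM ler_nat; nia.
by split; apply: le.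
Qed.

(** Induction on [j] through the two index-shifting identities, starting from the L^1 bound. Each
    ladder coefficient is at most 2(n+1), whence one power per factor of xi. *)
Lemma herm_trig_decay (j : nat) : exists2 A : R, 0 <= A & forall n xi,
  `|xi| ^+ j * `|herm_cos n xi| <= A * (2 * n.+1)%:R ^+ j.+1 /\
  `|xi| ^+ j * `|herm_sin n xi| <= A * (2 * n.+1)%:R ^+ j.+1.
Proof.
elim: j => [|j [A A0 IH]].
  have [A A0 HA] := Rint_norm_herm_le R; exists A => // n xi.
  have ih := integrable_herm R n; have mh := integrableR_measurable ih.
  have cc : continuous (@cos R) by exact: continuous_cos.
  have cs : continuous (@sin R) by exact: continuous_sin.
  rewrite expr0 expr1 !mul1r; split; apply: le_trans (HA n);
    apply: normr_Rint_le (integrableR_abs ih) _; try exact: measurable_mul_dilation.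
    by move=> x; rewrite normrM ler_piMr // cos_max.
  by move=> x; rewrite normrM ler_piMr // sin_max.
exists (A * 2 ^+ j.+1) => [|n xi]; first by rewrite mulr_ge0 ?exprn_ge0.
have [l1 l2] := ladder_le n; have l10 := ladder_ge0 R n; have l20 := ladder_ge0 R n.+1.
set r := (2 * n.+1)%:R in l1 l2 *; have r0 : 0 <= r by rewrite /r.
(* [u], [v], [w] stand for transforms of index n, n - 1, n + 1. Both neighbouring bases are at most
   2 * r, which is the origin of the factor 2 ^+ j.+1. *)
have key (u v w : R) : `|xi| ^+ j * `|v| <= A * (2 * n.-1.+1)%:R ^+ j.+1 ->
    `|xi| ^+ j * `|w| <= A * (2 * n.+2)%:R ^+ j.+1 ->
    `|xi * u| = `|2^-1 * (ladder R n.+1 * w - ladder R n * v)| ->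
    `|xi| ^+ j.+1 * `|u| <= A * 2 ^+ j.+1 * r ^+ j.+2.
  move=> Hv Hw E; rewrite exprSr -mulrA -normrM E normrM ger0_norm ?invr_ge0 //.
  have Hv' : `|xi| ^+ j * `|v| <= A * (2 * r) ^+ j.+1.
    apply: le_trans Hv _; rewrite ler_wpM2l // lerXn2r ?nnegrE ?mulr_ge0 //.
    by rewrite -natrM ler_nat; lia.
  have Hw' : `|xi| ^+ j * `|w| <= A * (2 * r) ^+ j.+1.
    apply: le_trans Hw _; rewrite ler_wpM2l // lerXn2r ?nnegrE ?mulr_ge0 //.
    by rewrite -natrM ler_nat; lia.
  have -> : A * 2 ^+ j.+1 * r ^+ j.+2 =
      2^-1 * (r * (A * (2 * r) ^+ j.+1) + r * (A * (2 * r) ^+ j.+1)).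
    by rewrite exprMn [r ^+ j.+2]exprS; field.
  rewrite mulrCA ler_wpM2l ?invr_ge0 //.
  apply: le_trans (ler_wpM2l (exprn_ge0 _ _) (ler_normB _ _)) _ => //.
  rewrite mulrDr !normrM !(ger0_norm (ladder_ge0 _ _)).
  by apply: lerD; rewrite mulrCA ler_pM ?mulr_ge0 ?exprn_ge0.
have [c1 s1] := IH n.-1 xi; have [c2 s2] := IH n.+1 xi; split.
  by apply: (key _ _ _ s1 s2); rewrite herm_cos_mul.
by apply: (key _ _ _ c1 c2); rewrite herm_sin_mul -opprB mulrN normrN.
Qed.

Lemma herm_trig_decay3 : exists2 D : R, 0 <= D & forall n xi,
  (1 + xi ^+ 2) * (1 + `|xi|) * `|herm_cos n xi| <= D * (2 * n.+1)%:R ^+ 4 /\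
  (1 + xi ^+ 2) * (1 + `|xi|) * `|herm_sin n xi| <= D * (2 * n.+1)%:R ^+ 4.
Proof.
have [A0 A00 H0] := herm_trig_decay 0; have [A1 A10 H1] := herm_trig_decay 1.
have [A2 A20 H2] := herm_trig_decay 2; have [A3 A30 H3] := herm_trig_decay 3.
exists (A0 + A1 + A2 + A3) => [|n xi]; first by rewrite !addr_ge0.
have key (u : R) : (forall (j : nat) (A : R), (forall n xi,
  `|xi| ^+ j * `|herm_cos n xi| <= A * (2 * n.+1)%:R ^+ j.+1 /\
  `|xi| ^+ j * `|herm_sin n xi| <= A * (2 * n.+1)%:R ^+ j.+1) ->
   `|xi| ^+ j * `|u| <= A * (2 * n.+1)%:R ^+ j.+1) ->
  (1 + xi ^+ 2) * (1 + `|xi|) * `|u| <= (A0 + A1 + A2 + A3) * (2 * n.+1)%:R ^+ 4.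
  move=> Hu; have {H0} := Hu _ _ H0; have {H1} := Hu _ _ H1.
  have {H2} := Hu _ _ H2; have {H3} := Hu _ _ H3.
  have r1 : 1 <= (2 * n.+1)%:R :> R by rewrite ler1n.
  rewrite -(real_normK (num_real xi)); set r := (2 * n.+1)%:R in r1 *.
  set z := `|xi|; set w := `|u| => h3 h2 h1 h0.
  have -> : (1 + z ^+ 2) * (1 + z) * w =
    z ^+ 0 * w + z ^+ 1 * w + z ^+ 2 * w + z ^+ 3 * w by ring.
  rewrite !mulrDl; apply: lerD => //; apply: lerD; last first.
    by apply: le_trans h2 _; rewrite ler_wpM2l // ler_weXn2l.
  apply: lerD; last by apply: le_trans h1 _; rewrite ler_wpM2l // ler_weXn2l.
  by apply: le_trans h0 _; rewrite ler_wpM2l // ler_weXn2l.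
by split; apply: key => j A HA; have [] := HA n xi.
Qed.

End FourierHermite.

(** * Coefficients of the field operators *)

Section IndicatorTransform.
Variable R : realType.
Local Notation Rint := (@Defs.Rint R).
Implicit Types (t s x xi : R) (f F g : R -> R).

Lemma measurable_ind0 t : measurable_fun [set: R] (ind0 t).
Proof.
have [t0|t0] := leP 0 t.
  rewrite (_ : ind0 t = \1_(`[0, t]%classic)).
    by apply: measurable_indic; exact: measurable_itv.
  by apply/funext => x; rewrite /ind0 t0 indicE mem_setE in_itv /=; case: ifP.
rewrite (_ : ind0 t = fun x => - \1_(`[t, 0]%classic) x).
  by apply: measurableT_comp => //; apply: measurable_indic; exact: measurable_itv.
apply/funext => x; rewrite /ind0 leNgt t0 /= indicE mem_setE in_itv /=.
by case: ifP => _ //; rewrite oppr0.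
Qed.

Lemma ind0_neq0 t x : ind0 t x != 0 -> `|x| <= `|t| /\ `|ind0 t x| = 1.
Proof.
rewrite /ind0; case: leP => t0; case: ifP => [/andP[h1 h2] _|]; rewrite ?eqxx //.
  by rewrite normr1 !ger0_norm.
by rewrite normrN normr1 !ler0_norm ?lerN2 // ltW.
Qed.

Lemma normr_ind0_le t x : `|ind0 t x| <= (1 + t ^+ 2) * (1 + x ^+ 2)^-1.
Proof.
have [->|/ind0_neq0 [xt ->]] := eqVneq (ind0 t x) 0.
  by rewrite normr0 divr_ge0 // ltW // oneDsqr_gt0.
rewrite ler_pdivlMr ?oneDsqr_gt0 // mul1r lerD2l.
by rewrite -(real_normK (num_real x)) -(real_normK (num_real t)) lerXn2r ?nnegrE.
Qed.

Lemma integrable_ind0 t : integrableR (ind0 t).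
Proof.
apply: le_integrableR (normr_ind0_le t); first exact: measurable_ind0.
exact/integrableRZ/integrableR_inv_oneDsqr.
Qed.

Lemma integrable_id_ind0 t : integrableR (fun x => x * ind0 t x).
Proof.
apply: (@le_integrableR _ _ (fun x => `|t| * `|ind0 t x|)).
- by apply: measurable_funM => //; exact: measurable_ind0.
- exact/integrableRZ/integrableR_abs/integrable_ind0.
- move=> x; rewrite normrM.
  have [->|/ind0_neq0 [xt _]] := eqVneq (ind0 t x) 0; first by rewrite normr0 !mulr0.
  by rewrite ler_wpM2r.
Qed.

(** The sign of [ind0] for negative t makes one formula valid for all real t. *)
Lemma Rint_ind0 t f F : continuous f -> (forall x, is_derive x 1 F (f x)) ->
  Rint (fun x => ind0 t x * f x) = F t - F 0.
Proof.
move=> cf dF; have [t0|t0] := leP 0 t.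
  rewrite -(Rint_itv_FTC cf dF t0) Rintegral_mkcond.
  congr Defs.Rint; apply/funext => x.
  rewrite /ind0 t0 patchE mem_setE in_itv /=; case: ifP => _; rewrite ?mul1r ?mul0r //.
have dF' x : is_derive x 1 (fun y => -1 * F y) (-1 * f x) := is_derive1_scale (-1) (dF x).
have cf' : continuous (fun x => -1 * f x).
  by move=> x; apply: cvgM; [exact: cvg_cst|exact: cf].
have := Rint_itv_FTC cf' dF' (ltW t0); rewrite !mulN1r opprK addrC => <-.
rewrite Rintegral_mkcond; congr Defs.Rint; apply/funext => x.
rewrite /ind0 leNgt t0 /= patchE mem_setE in_itv /=; case: ifP => _; rewrite ?mul0r //.
Qed.

(** What the estimates use of sine and cosine, so that each is proved once. The primitive is only
    asserted to exist because the formula dividing by xi fails at xi = 0. *)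
Definition trig_like g := [/\ forall x, `|g x| <= 1,
  forall x y, `|g x - g y| <= `|x - y| &
  forall xi, exists F, forall x, is_derive x 1 F (g (x * xi))].

Lemma trig_like_cos : trig_like cos.
Proof.
split=> [||xi]; [exact: cos_max|exact: cos_lipschitz|].
have [->|xi0] := eqVneq xi 0.
  by exists id => x; apply: (is_derive_eq (is_derive1_id x)); rewrite mulr0 cos0.
exists (fun x => xi^-1 * sin (x * xi)) => x.
apply: (is_derive_eq (is_derive1_scale xi^-1 (is_derive_sin_scale xi x))).
by rewrite mulKf.
Qed.

Lemma trig_like_sin : trig_like sin.
Proof.
split=> [||xi]; [exact: sin_max|exact: sin_lipschitz|].
have [->|xi0] := eqVneq xi 0.
  exists (fun=> 0) => x; apply: (is_derive_eq (is_derive1_const 0 x)).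
  by rewrite mulr0 sin0.
exists (fun x => - xi^-1 * cos (x * xi)) => x.
apply: (is_derive_eq (is_derive1_scale (- xi^-1) (is_derive_cos_scale xi x))).
by rewrite mulrNN mulKf.
Qed.

Definition ind0_transform g t xi := Rint (fun x => ind0 t x * g (x * xi)).

Lemma continuous_dilation g xi : trig_like g -> continuous (fun x => g (x * xi)).
Proof.
move=> [_ gL _]; apply: (@continuous_of_lipschitz _ _ `|xi|) => x y.
by apply: le_trans (gL _ _) _; rewrite -mulrBl normrM mulrC.
Qed.

Lemma ind0_transform_continuous g t : trig_like g -> continuous (ind0_transform g t).
Proof.
move=> [g1 gL _]; apply: continuous_Rint_dilation => //.
  exact: integrable_ind0.
exact: integrable_id_ind0.
Qed.

(** One primitive serves all t at fixed xi, so differences in t become increments of F. *)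
Lemma ind0_transform_primitive g xi : trig_like g ->
  exists F, (forall x, is_derive x 1 F (g (x * xi))) /\
    forall t, ind0_transform g t xi = F t - F 0.
Proof.
move=> gt; have [g1 gL /(_ xi) [F dF]] := gt; exists F; split=> // t.
by apply: Rint_ind0 => //; exact: continuous_dilation.
Qed.

Lemma ind0_transform_le g t xi : trig_like g -> `|ind0_transform g t xi| <= `|t|.
Proof.
move=> gt; have [F [dF ->]] := ind0_transform_primitive xi gt.
rewrite -[leRHS]mul1r -[in leRHS](subr0 t).
by apply: (lipschitz_of_derive dF) => x; case: gt.
Qed.

Lemma ind0_transform_diff g t u xi : trig_like g ->
  `|ind0_transform g (t + u) xi - ind0_transform g t xi| <= `|u|.
Proof.
move=> gt; have [F [dF FE]] := ind0_transform_primitive xi gt.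
rewrite !FE opprB addrA subrK -[leRHS]mul1r (_ : u = t + u - t); last by ring.
rewrite {1}(_ : t + (t + u - t) = t + u); last by ring.
by apply: (lipschitz_of_derive dF) => x; case: gt.
Qed.

(** A second difference is an increment of y |-> F(y + u) - F(y), whose derivative is at most |u|
    |xi| since g is 1-Lipschitz. *)
Lemma ind0_transform_diff2 g t s u xi : trig_like g ->
  `|(ind0_transform g (t + u) xi - ind0_transform g t xi)
    - (ind0_transform g (s + u) xi - ind0_transform g s xi)|
  <= `|u| * `|t - s| * `|xi|.
Proof.
move=> gt; have [F [dF FE]] := ind0_transform_primitive xi gt.
have [g1 gL _] := gt; rewrite !FE.
have dS x : is_derive x 1 (fun y => F (y + u) - F y) (g ((x + u) * xi) - g (x * xi)).
  apply: is_derive1_sub (dF x).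
  have dl : is_derive x 1 (fun y => y + u) 1.
    apply: (is_derive_eq (is_derive1_add (is_derive1_id x) (is_derive1_const u x))).
    by rewrite addr0.
  apply: (is_derive_eq (@is_derive1_compose _ F (fun y => y + u) x _ _ (dF _) dl)).
  by rewrite mulr1.
have := @lipschitz_of_derive _ _ _ (`|u| * `|xi|) dS.
have -> : F (t + u) - F 0 - (F t - F 0) - (F (s + u) - F 0 - (F s - F 0)) =
  F (t + u) - F t - (F (s + u) - F s) by ring.
rewrite [leRHS]mulrAC; apply=> x.
by apply: le_trans (gL _ _) _; rewrite -mulrBl normrM addrC addKr.
Qed.

End IndicatorTransform.

(** * Pairing the indicators with the Hermite functions through sqrt m *)

Section Coefficients.
Variables (R : realType) (m : R -> R).
Hypothesis m_meas : measurable_fun [set: R] m.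
Hypothesis m_ge0 : forall u, 0 <= m u.
Hypothesis m_int : (\int[@lebesgue_measure R]_(u in [set: R])
  (m u / (1 + u ^+ 2))%:E < +oo)%E.
Local Notation Rint := (@Defs.Rint R).
Implicit Types (t s u xi kappa : R) (q e : R -> R) (k : nat).

Let rho xi := (1 + m xi) / (1 + xi ^+ 2).

Lemma integrable_rho : integrableR rho.
Proof.
have -> : rho = fun xi => (1 + xi ^+ 2)^-1 + m xi / (1 + xi ^+ 2).
  by apply/funext => xi; rewrite /rho mulrDl mul1r.
have i1 := integrableR_inv_oneDsqr R; apply: integrableRD => //.
apply/integrableP; split.
  apply/measurable_EFinP; apply: measurable_funM => //.
  exact: integrableR_measurable i1.
under eq_integral => x _ do
  rewrite /= ger0_norm ?(divr_ge0 (m_ge0 x) (ltW (oneDsqr_gt0 x))) //.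
exact: m_int.
Qed.

Definition sqrtm_pair q e := Rint (fun xi => Num.sqrt (m xi) * q xi * e xi).

(** Calibrated against [grows]: the product of the two functions is at most kappa * D / (1 + xi^2),
    the weight under which 1 + m is integrable. *)
Definition decays (D : R) e :=
  continuous e /\ forall xi, (1 + xi ^+ 2) * (1 + `|xi|) * `|e xi| <= D.

Definition grows kappa q :=
  continuous q /\ forall xi, `|q xi| <= kappa * (1 + `|xi|).

(* sqrt m <= 1 + m, so the integrability of m / (1 + u^2) suffices *)
Lemma sqrtm_pair_dominated D e kappa q xi : decays D e -> grows kappa q ->
  `|Num.sqrt (m xi) * q xi * e xi| <= kappa * D * rho xi.
Proof.
move=> [_ eD] [_ qk]; have x0 := oneDsqr_gt0 xi.
have sm : `|Num.sqrt (m xi)| <= 1 + m xi.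
  rewrite ger0_norm ?sqrtr_ge0 //; have := sqr_sqrtr (m_ge0 xi).
  set z := Num.sqrt _ => <-; have := sqr_ge0 (z - 1); have := sqr_ge0 z; nra.
have y0 : 0 < 1 + `|xi| by rewrite ltr_pwDl.
rewrite !normrM /rho mulrCA -mulrA ler_pM ?mulr_ge0 //.
rewrite ler_pdivlMr // -mulrA.
apply: le_trans (ler_wpM2r _ (qk xi)) _; first by rewrite mulr_ge0 // ltW.
rewrite -mulrA; have k0 : 0 <= kappa.
  by have := le_trans (normr_ge0 _) (qk 0); rewrite normr0 addr0 mulr1.
rewrite ler_wpM2l //; apply: le_trans (eD xi).
by rewrite [leLHS](_ : _ = (1 + xi ^+ 2) * (1 + `|xi|) * `|e xi|) //; ring.
Qed.

Lemma sqrtm_pair_integrable D e kappa q : decays D e -> grows kappa q ->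
  integrableR (fun xi => Num.sqrt (m xi) * q xi * e xi).
Proof.
move=> eD qk; apply: (le_integrableR _ (integrableRZ (kappa * D) integrable_rho)).
  apply: measurable_funM; last by apply: continuous_measurable_fun; case: eD.
  apply: measurable_funM; last by apply: continuous_measurable_fun; case: qk.
  apply: (measurableT_comp _ m_meas).
  by apply: continuous_measurable_fun; exact: sqrt_continuous.
by move=> xi; exact: sqrtm_pair_dominated.
Qed.

Lemma sqrtm_pairB D e kappa q kappa' q' : decays D e ->
  grows kappa q -> grows kappa' q' ->
  sqrtm_pair q e - sqrtm_pair q' e = sqrtm_pair (fun xi => q xi - q' xi) e.
Proof.
move=> eD qk qk'; rewrite /sqrtm_pair -RintB.
- by congr Defs.Rint; apply/funext => xi; ring.
- exact: sqrtm_pair_integrable eD qk.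
- exact: sqrtm_pair_integrable eD qk'.
Qed.

Lemma sqrtm_pair_le D e kappa q : decays D e -> grows kappa q ->
  `|sqrtm_pair q e| <= kappa * (D * Rint rho).
Proof.
move=> eD qk; rewrite mulrA -RintZ; last exact: integrable_rho.
apply: normr_Rint_le => [||xi]; last exact: sqrtm_pair_dominated.
  by apply: integrableR_measurable; exact: sqrtm_pair_integrable eD qk.
exact/integrableRZ/integrable_rho.
Qed.

Lemma growsB kappa q kappa' q' : grows kappa q -> grows kappa' q' ->
  grows (kappa + kappa') (fun xi => q xi - q' xi).
Proof.
move=> [cq qk] [cq' qk']; split=> xi; first exact: cvgB (cq xi) (cq' xi).
by rewrite mulrDl; apply: le_trans (ler_normB _ _) (lerD _ _).
Qed.

Lemma grows_ind0 g t : trig_like g -> grows `|t| (ind0_transform g t).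
Proof.
move=> gt; split=> [|xi]; first exact: ind0_transform_continuous.
by apply: le_trans (ind0_transform_le _ _ gt) _; rewrite ler_peMr // lerDl.
Qed.

Definition ind0_pair g e t := sqrtm_pair (ind0_transform g t) e.

(** By linearity, differences of pairings are pairings of differences; the three bounds are
    [sqrtm_pair_le] with kappa equal to |t|, |u| and |u| |t - s|. *)
Lemma ind0_pair_bounds D e g t s u : decays D e -> trig_like g ->
  [/\ `|ind0_pair g e t| <= `|t| * (D * Rint rho),
      `|ind0_pair g e (t + u) - ind0_pair g e t| <= `|u| * (D * Rint rho) &
      `|(ind0_pair g e (t + u) - ind0_pair g e t)
        - (ind0_pair g e (s + u) - ind0_pair g e s)| <=
        `|u| * `|t - s| * (D * Rint rho)].
Proof.
move=> eD gt; have gi v := grows_ind0 v gt.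
have pB v : ind0_pair g e (v + u) - ind0_pair g e v = _ :=
  sqrtm_pairB eD (gi (v + u)) (gi v).
split; first exact: sqrtm_pair_le.
  rewrite (pB t); apply: sqrtm_pair_le => //.
  split=> xi; first exact: (growsB (gi _) (gi _)).1.
  by apply: le_trans (ind0_transform_diff _ _ _ gt) _; rewrite ler_peMr // lerDl.
have gB v := growsB (gi (v + u)) (gi v).
rewrite (etrans (congr2 (fun x y => x - y) (pB t) (pB s))
  (sqrtm_pairB eD (gB t) (gB s))).
apply: sqrtm_pair_le => //.
split=> xi; first exact: (growsB (gB t) (gB s)).1.
apply: le_trans (ind0_transform_diff2 _ _ _ _ gt) _.
by rewrite ler_wpM2l ?mulr_ge0 // lerDr.
Qed.

Lemma decays_herm : exists2 D : R, 0 <= D & forall k,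
  decays (D * (2 * k.+1)%:R ^+ 4) (herm_cos k) /\
  decays (D * (2 * k.+1)%:R ^+ 4) (herm_sin k).
Proof.
have [D D0 HD] := herm_trig_decay3 R; exists D => // k.
have i1 := integrable_herm R k; have i2 := integrable_id_herm R k.
split; split=> [|xi].
- by apply: continuous_Rint_dilation => //; [exact: cos_max|exact: cos_lipschitz].
- by have [] := HD k xi.
- by apply: continuous_Rint_dilation => //; [exact: sin_max|exact: sin_lipschitz].
- by have [] := HD k xi.
Qed.

(** One normalising factor from each of the two Fourier transforms in [gcoef]. *)
Let c : R := (Num.sqrt (2 * pi))^-1 ^+ 2.

(** Expansion of (C - i S) times the conjugate of (C_k - i S_k) into real and imaginary parts;
    [cim_gcoef] is the other half. *)
Lemma cre_gcoef t k : cre (gcoef m t k) =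
  c * (ind0_pair cos (herm_cos k) t + ind0_pair sin (herm_sin k) t).
Proof.
have [D D0 /(_ k) [dc ds]] := decays_herm.
have i1 := sqrtm_pair_integrable dc (grows_ind0 t (trig_like_cos R)).
have i2 := sqrtm_pair_integrable ds (grows_ind0 t (trig_like_sin R)).
rewrite -RintD // -RintZ; last exact: integrableRD.
congr Defs.Rint; apply/funext => xi; rewrite !creM /= /c /herm_cos /herm_sin
  /ind0_transform; ring.
Qed.

Lemma cim_gcoef t k : cim (gcoef m t k) =
  c * (ind0_pair cos (herm_sin k) t - ind0_pair sin (herm_cos k) t).
Proof.
have [D D0 /(_ k) [dc ds]] := decays_herm.
have i1 := sqrtm_pair_integrable ds (grows_ind0 t (trig_like_cos R)).
have i2 := sqrtm_pair_integrable dc (grows_ind0 t (trig_like_sin R)).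
rewrite -RintB // -RintZ; last exact: integrableRB.
congr Defs.Rint; apply/funext => xi; rewrite !cimM !creM /= /c /herm_cos /herm_sin
  /ind0_transform; ring.
Qed.

Lemma gcoef_bounds : exists2 L : R, 0 <= L & forall t s u k,
  [/\ cabs (gcoef m t k) <= `|t| * (L * (2 * k.+1)%:R ^+ 4),
      cabs (gcoef m (t + u) k - gcoef m t k) <= `|u| * (L * (2 * k.+1)%:R ^+ 4) &
      cabs ((gcoef m (t + u) k - gcoef m t k) - (gcoef m (s + u) k - gcoef m s k))
        <= `|u| * `|t - s| * (L * (2 * k.+1)%:R ^+ 4)].
Proof.
have [D D0 HD] := decays_herm.
have J0 : 0 <= Rint rho.
  by apply: Rint_ge0 => xi; rewrite divr_ge0 ?addr_ge0 ?sqr_ge0.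
have c0 : 0 <= c by rewrite exprn_ge0 // invr_ge0 sqrtr_ge0.
exists (4 * c * (D * Rint rho)) => [|t s u k]; first by rewrite !mulr_ge0.
have [dc ds] := HD k; set r := (2 * k.+1)%:R ^+ 4 in dc ds *.
have [a1 a2 a3] := ind0_pair_bounds t s u dc (trig_like_cos R).
have [b1 b2 b3] := ind0_pair_bounds t s u ds (trig_like_cos R).
have [c1 c2 c3] := ind0_pair_bounds t s u dc (trig_like_sin R).
have [d1 d2 d3] := ind0_pair_bounds t s u ds (trig_like_sin R).
(* [M] will be |t|, |u| and |u| |t - s| in turn. Each coefficient involves four real pairings, hence
   the constant 4 * c. *)
have key (z : R[i]) (M x1 x2 x3 x4 : R) :
    cre z = c * (x1 + x2) -> cim z = c * (x3 - x4) ->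
    `|x1| <= M * (D * r * Rint rho) -> `|x2| <= M * (D * r * Rint rho) ->
    `|x3| <= M * (D * r * Rint rho) -> `|x4| <= M * (D * r * Rint rho) ->
    cabs z <= M * (4 * c * (D * Rint rho) * r).
  move=> rz iz; set B := M * (D * r * Rint rho) => h1 h2 h3 h4.
  apply: le_trans (cabs_le_re_im z) _; rewrite rz iz !(normrM c) (ger0_norm c0).
  rewrite -mulrDr [leRHS](_ : _ = c * (B + B + (B + B))); last by rewrite /B; ring.
  rewrite ler_wpM2l // lerD //.
    by apply: le_trans (ler_normD _ _) (lerD _ _).
  by apply: le_trans (ler_normB _ _) (lerD _ _).
have re2 (x y x' y' : R) :
    c * (x + y) - c * (x' + y') = c * ((x - x') + (y - y')) by ring.
have im2 (x y x' y' : R) :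
    c * (x - y) - c * (x' - y') = c * ((x - x') - (y - y')) by ring.
have sub2 (x y x' y' : R) : x = x' -> y = y' -> x - y = x' - y'.
  by move=> -> ->.
have reE t' := etrans (creB _ _)
  (etrans (sub2 _ _ _ _ (cre_gcoef (t' + u) k) (cre_gcoef t' k)) (re2 _ _ _ _)).
have imE t' := etrans (cimB _ _)
  (etrans (sub2 _ _ _ _ (cim_gcoef (t' + u) k) (cim_gcoef t' k)) (im2 _ _ _ _)).
split.
- exact: (key _ _ _ _ _ _ (cre_gcoef t k) (cim_gcoef t k) a1 d1 b1 c1).
- exact: (key _ _ _ _ _ _ (reE t) (imE t) a2 d2 b2 c2).
- exact: (key _ _ _ _ _ _
    (etrans (creB _ _) (etrans (sub2 _ _ _ _ (reE t) (reE s)) (re2 _ _ _ _)))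
    (etrans (cimB _ _) (etrans (sub2 _ _ _ _ (imE t) (imE s)) (im2 _ _ _ _)))
    a3 d3 b3 c3).
Qed.

End Coefficients.

(** * Bounds on the derivative *)

Section ScalarSums.
Variable R : realType.
Implicit Types (u v : nat -> R) (y z : nat -> R[i]).

Lemma esum_letter_le u (C : R) : 0 <= C ->
  (forall k, u k <= C * (2 * k.+1)%:R ^- 2) ->
  (\esum_(k in [set: nat]) (u k)%:E <= (C / 2)%:E)%E.
Proof.
move=> C0 uC; apply: esum_le_of_seq => s us.
apply: le_trans (ler_sum _ (fun k _ => uC k)) _.
rewrite -mulr_sumr ler_wpM2l //.
pose K := (\max_(k <- s) k).+1.
apply: le_trans (sum_letter_inv2_le R K); apply: ler_sum_subseq => // k ks.
by rewrite mem_iota add0n ltnS; exact: (bigmaxn_sup_seq k).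
Qed.

(** Finiteness guarantees that [fine] in [rsum] returns the actual sum and not its default value. *)
Lemma esum_part_bounds u (C : R) : 0 <= C ->
  (forall k, `|u k| <= C * (2 * k.+1)%:R ^- 2) ->
  exists2 a : R, 0 <= a <= C / 2 &
    (\esum_(k in [set: nat]) (Num.max (u k) 0)%:E = a%:E)%E.
Proof.
move=> C0 uC.
have le : (\esum_(k in [set: nat]) (Num.max (u k) 0)%:E <= (C / 2)%:E)%E.
  apply: esum_letter_le => // k; rewrite ge_max mulr_ge0 // andbT.
  exact: le_trans (ler_norm _) (uC k).
have ge : (0 <= \esum_(k in [set: nat]) (Num.max (u k) 0)%:E)%E.
  by apply: esum_ge0 => k _; rewrite lee_fin le_max lexx orbT.
move: le ge; case: esum => // a; rewrite !lee_fin => h1 h2.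
by exists a; rewrite ?h1 ?h2.
Qed.

Lemma rsum_le u (C : R) : 0 <= C ->
  (forall k, `|u k| <= C * (2 * k.+1)%:R ^- 2) -> `|rsum u| <= C / 2.
Proof.
move=> C0 uC; rewrite /rsum.
have [a /andP[a0 aC] ->] := esum_part_bounds C0 uC.
have uC' k : `|- u k| <= C * (2 * k.+1)%:R ^- 2 by rewrite normrN.
have [b /andP[b0 bC] ->] := esum_part_bounds C0 uC'.
by rewrite /= ler_norml; lra.
Qed.

Lemma max0B (x : R) : Num.max x 0 - Num.max (- x) 0 = x.
Proof. by case: (leP x 0); case: (leP (- x) 0); lra. Qed.

Lemma rsumB u v (C : R) : 0 <= C ->
  (forall k, `|u k| <= C * (2 * k.+1)%:R ^- 2) ->
  (forall k, `|v k| <= C * (2 * k.+1)%:R ^- 2) ->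
  rsum (fun k => u k - v k) = rsum u - rsum v.
Proof.
move=> C0 uC vC; rewrite /rsum.
have uC' k : `|- u k| <= C * (2 * k.+1)%:R ^- 2 by rewrite normrN.
have vC' k : `|- v k| <= C * (2 * k.+1)%:R ^- 2 by rewrite normrN.
have wC k : `|u k - v k| <= (C + C) * (2 * k.+1)%:R ^- 2.
  by rewrite mulrDl; apply: le_trans (ler_normB _ _) (lerD _ _).
have wC' k : `|- (u k - v k)| <= (C + C) * (2 * k.+1)%:R ^- 2 by rewrite normrN.
have [a _ Ea] := esum_part_bounds C0 uC; have [a' _ Ea'] := esum_part_bounds C0 uC'.
have [b _ Eb] := esum_part_bounds C0 vC; have [b' _ Eb'] := esum_part_bounds C0 vC'.
have [c _ Ec] := esum_part_bounds (addr_ge0 C0 C0) wC.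
have [c' _ Ec'] := esum_part_bounds (addr_ge0 C0 C0) wC'.
have mx (x : R) : 0 <= Num.max x 0 by rewrite le_max lexx orbT.
(* Positive parts are not additive, so the claim is rearranged into an identity between sums of
   nonnegative terms: (u-v)^+ + u^- + v^+ = (u-v)^- + u^+ + v^-. *)
have : (c%:E + (a'%:E + b%:E) = c'%:E + (a%:E + b'%:E))%E.
  rewrite -Ea -Ea' -Eb -Eb' -Ec -Ec'.
  rewrite -!esumD; try by move=> k kT; rewrite -?EFinD lee_fin ?addr_ge0 ?mx.
  apply: eq_esum => k _; rewrite -!EFinD; congr EFin.
    have := max0B (u k); have := max0B (v k); have := max0B (u k - v k).
    by lra.
rewrite -!EFinD Ea Eb Ec Ea' Eb' Ec' /= => -[]; lra.
Qed.

Lemma csum_le z (C : R) : 0 <= C ->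
  (forall k, cabs (z k) <= C * (2 * k.+1)%:R ^- 2) -> cabs (csum z) <= C.
Proof.
move=> C0 zC; apply: le_trans (cabs_le_re_im _) _.
rewrite [leRHS](_ : _ = C / 2 + C / 2); last by field.
by apply: lerD; apply: rsum_le => // k; apply: le_trans (zC k);
  [exact: cre_le_cabs|exact: cim_le_cabs].
Qed.

Lemma csumB y z (C : R) : 0 <= C ->
  (forall k, cabs (y k) <= C * (2 * k.+1)%:R ^- 2) ->
  (forall k, cabs (z k) <= C * (2 * k.+1)%:R ^- 2) ->
  csum (fun k => y k - z k) = csum y - csum z.
Proof.
move=> C0 yC zC.
have re (x : nat -> R[i]) : (forall k, cabs (x k) <= C * (2 * k.+1)%:R ^- 2) ->
    forall k, `|cre (x k)| <= C * (2 * k.+1)%:R ^- 2.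
  by move=> xC k; exact: le_trans (cre_le_cabs _) (xC k).
have im (x : nat -> R[i]) : (forall k, cabs (x k) <= C * (2 * k.+1)%:R ^- 2) ->
    forall k, `|cim (x k)| <= C * (2 * k.+1)%:R ^- 2.
  by move=> xC k; exact: le_trans (cim_le_cabs _) (xC k).
rewrite /csum; apply/eqP; rewrite eq_complex /=; apply/andP; split; apply/eqP.
  rewrite -(rsumB C0 (re _ yC) (re _ zC)); congr rsum; apply/funext => k.
  by rewrite creD creN.
rewrite -(rsumB C0 (im _ yC) (im _ zC)); congr rsum; apply/funext => k.
by rewrite cimD cimN.
Qed.

End ScalarSums.

(** * Field operators and limits of their difference quotients *)

Section Derivative.
Variable R : realType.
Implicit Types (w : seq nat) (f F : fock R) (g : nat -> R[i]).

Lemma inS1_decay f (p : nat) : inS1 f ->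
  exists2 A : R, 0 <= A & forall w, cabs (f w) <= A * word_size R w ^- p.
Proof.
move=> /(_ (2 * p)%N) /inGamma_lt [r r0 /fnorm2_lt_coord fr].
exists (1 + r) => [|w]; first by rewrite addr_ge0.
have wp := exprn_gt0 p (word_size_gt0 R w).
rewrite cabs_le_sqr ?divr_ge0 ?addr_ge0 ?(ltW wp) // exprMn exprVn -exprM mulnC.
rewrite ler_pdivlMr ?exprn_gt0 ?word_size_gt0 // -weight_pos.
by apply: le_trans (ltW (fr w)) _; nra.
Qed.

(** [Xm m t f] is convertible to [field_op (gcoef m t) f]; the abstraction allows differences of
    coefficient sequences as arguments. *)
Definition field_op g f : fock R := fadd (creation g f) (annihilation g f).

(** Growth of order 4 against decay of order 6 leaves the summable power -2 of the letter. *)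
Lemma annihilation_term_le g f (C A : R) (k : nat) w : 0 <= C -> 0 <= A ->
  (forall k, cabs (g k) <= C * (2 * k.+1)%:R ^+ 4) ->
  (forall w, cabs (f w) <= A * word_size R w ^- 6) ->
  cabs (cconj (g k) * f (k :: w)) <= C * A * (2 * k.+1)%:R ^- 2.
Proof.
move=> C0 A0 gC fA; rewrite cabsM cabs_conj.
apply: le_trans (ler_pM (cabs_ge0 _) (cabs_ge0 _) (gC k) (fA _)) _.
have r2 := letter_ge2 R k; have w1 := word_size_ge1 R w.
rewrite word_size_cons; set r := (2 * k.+1)%:R in r2 *.
have r0 : 0 < r by lra.
have w6 : 1 <= word_size R w ^+ 6 by rewrite exprn_ege1.
rewrite exprMn invfM; set z := _ ^+ 6 in w6 *.
have z0 : 0 < z by lra.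
have -> : C * r ^+ 4 * (A * (r ^- 6 * z^-1)) = C * A * r ^- 2 * z^-1.
  by field; rewrite !gt_eqF.
rewrite ler_piMr ?mulr_ge0 ?invr_ge0 ?exprn_ge0 ?(ltW r0) //.
by rewrite invf_le1.
Qed.

(** Annihilation is antilinear in [g] but still additive. The growth bounds secure the absolute
    convergence needed to split [csum]. *)
Lemma field_opB g g' f (C : R) w : 0 <= C -> inS1 f ->
  (forall k, cabs (g k) <= C * (2 * k.+1)%:R ^+ 4) ->
  (forall k, cabs (g' k) <= C * (2 * k.+1)%:R ^+ 4) ->
  field_op (fun k => g k - g' k) f w = field_op g f w - field_op g' f w.
Proof.
move=> C0 fS gC g'C; have [A A0 fA] := inS1_decay 6 fS.
rewrite /field_op /fadd.
have -> : creation (fun k => g k - g' k) f w = creation g f w - creation g' f w.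
  by case: w => [|k w] /=; rewrite ?subr0 // mulrBl.
have -> : annihilation (fun k => g k - g' k) f w =
    annihilation g f w - annihilation g' f w.
  rewrite /annihilation -(csumB (mulr_ge0 C0 A0)) => [|k|k].
  - congr csum; apply/funext => k; rewrite -mulrBl; congr (_ * _).
    case: (g k) (g' k) => [a b] [a' b'] /=.
    by apply/eqP; rewrite eq_complex /= opprD !eqxx.
  - exact: annihilation_term_le.
  - exact: annihilation_term_le.
by rewrite opprD addrACA.
Qed.

(** The bound is homogeneous in kappa, with [B] independent of [g], so that the factors |u| and |u|
    |t - s| survive to be divided by |u|. *)
Lemma field_op_le f (C : R) : 0 <= C -> inS1 f ->
  exists2 B : R, 0 <= B & forall g kappa w, 0 <= kappa ->
    (forall k, cabs (g k) <= kappa * (C * (2 * k.+1)%:R ^+ 4)) ->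
    cabs (field_op g f w) <= kappa * (B * word_size R w ^+ 4).
Proof.
move=> C0 fS; have [A A0 fA] := inS1_decay 6 fS.
exists (C * A + C * A) => [|g kappa w k0 gk]; first by rewrite addr_ge0 ?mulr_ge0.
have w1 v : 1 <= word_size R v by exact: word_size_ge1.
have fA' v : cabs (f v) <= A.
  apply: le_trans (fA v) _; rewrite ler_piMr // invf_le1 ?exprn_ege1 //.
  by rewrite exprn_gt0 // word_size_gt0.
have gk' k : cabs (g k) <= kappa * C * (2 * k.+1)%:R ^+ 4 by rewrite -mulrA gk.
have kC0 : 0 <= kappa * C by rewrite mulr_ge0.
apply: le_trans (cabsD _ _) _; rewrite mulrDl mulrDr; apply: lerD.
  case: w => [|k w] /=.
    rewrite (_ : cabs 0 = 0) ?mulr_ge0 ?exprn_ge0 ?(le_trans ler01 (w1 _)) //.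
    by rewrite /cabs /cabs2 /= expr0n addr0 sqrtr0.
  rewrite cabsM; apply: le_trans (ler_pM (cabs_ge0 _) (cabs_ge0 _) (gk' k) (fA' w)) _.
  rewrite word_size_cons exprMn.
  rewrite [leRHS](_ : _ = kappa * C * (2 * k.+1)%:R ^+ 4 * A * word_size R w ^+ 4);
    last by ring.
  by rewrite ler_peMr ?exprn_ege1 // !mulr_ge0 // exprn_ge0.
apply: le_trans (csum_le (mulr_ge0 kC0 A0) _) _ => [k|].
  exact: annihilation_term_le.
rewrite [leRHS](_ : _ = kappa * C * A * word_size R w ^+ 4); last by ring.
by rewrite ler_peMr ?exprn_ege1 // !mulr_ge0.
Qed.

Lemma is_Wm_coord (m : R -> R) (W : R -> fock R -> fock R) f : is_Wm m W -> inS1 f ->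
  forall t w (e : R), 0 < e -> exists2 d : R, 0 < d & forall u, 0 < `|u| < d ->
    cabs ((u^-1)%:C%C * (Xm m (t + u) f w - Xm m t f w) - W t f w) <= e.
Proof.
move=> HW fS t w e e0; have [_ Wd] := HW t f fS.
have [d d0 Hd] := Wd _ (nbhd0_coord w e0).
by exists d => // u ud; have [_ /(_ 0%N)] := Hd u ud.
Qed.

(* Bounds on difference quotients pass to the limit coordinatewise, so no
   formula for the derivative is needed. *)
Lemma field_op_derivative_bounds (G : R -> nat -> R[i]) (V : R -> fock R) f (L : R) :
  0 <= L -> inS1 f ->
  (forall t s u k,
    [/\ cabs (G t k) <= `|t| * (L * (2 * k.+1)%:R ^+ 4),
        cabs (G (t + u) k - G t k) <= `|u| * (L * (2 * k.+1)%:R ^+ 4) &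
        cabs ((G (t + u) k - G t k) - (G (s + u) k - G s k))
          <= `|u| * `|t - s| * (L * (2 * k.+1)%:R ^+ 4)]) ->
  (forall t w (e : R), 0 < e -> exists2 d : R, 0 < d & forall u, 0 < `|u| < d ->
    cabs ((u^-1)%:C%C * (field_op (G (t + u)) f w - field_op (G t) f w) - V t w)
      <= e) ->
  exists2 B : R, 0 <= B & forall t s w,
    cabs (V t w) <= B * word_size R w ^+ 4 /\
    cabs (V t w - V s w) <= `|t - s| * (B * word_size R w ^+ 4).
Proof.
move=> L0 fS HL HX.
have [B B0 HB] := field_op_le L0 fS; exists B => // t s w.
have Xdiff t' u : field_op (G (t' + u)) f w - field_op (G t') f w =
    field_op (fun k => G (t' + u) k - G t' k) f w.
  (* A single constant has to bound both [G (t' + u)] and [G t']; it may depend on [u] because it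
     does not enter the result. *)
  rewrite (@field_opB _ _ _ ((`|t' + u| + `|t'|) * L)) //.
  - by rewrite mulr_ge0 ?addr_ge0.
  - move=> k; have [h _ _] := HL (t' + u) 0 0 k; apply: le_trans h _.
    by rewrite -mulrA ler_wpM2r ?mulr_ge0 ?exprn_ge0 // lerDl.
  - move=> k; have [h _ _] := HL t' 0 0 k; apply: le_trans h _.
    by rewrite -mulrA ler_wpM2r ?mulr_ge0 ?exprn_ge0 // lerDr.
have Xdiff_le t' u : cabs (field_op (G (t' + u)) f w - field_op (G t') f w) <=
    `|u| * (B * word_size R w ^+ 4).
  by rewrite Xdiff; apply: HB => // k; have [_ h _] := HL t' 0 u k.
have Xdiff2_le u : cabs ((field_op (G (t + u)) f w - field_op (G t) f w) -
    (field_op (G (s + u)) f w - field_op (G s) f w)) <=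
    `|u| * `|t - s| * (B * word_size R w ^+ 4).
  rewrite (Xdiff t) (Xdiff s) -(@field_opB _ _ _ (`|u| * L)) ?mulr_ge0 //.
  - by apply: HB => [|k]; [rewrite mulr_ge0|have [_ _ h] := HL t s u k].
  - by move=> k; have [_ h _] := HL t 0 u k; rewrite -mulrA.
  - by move=> k; have [_ h _] := HL s 0 u k; rewrite -mulrA.
have quot u (z : R[i]) (M : R) : 0 < `|u| -> cabs z <= `|u| * M ->
    cabs ((u^-1)%:C%C * z) <= M.
  by move=> u0 zM; rewrite cabsM cabs_real normfV ler_pdivrMl.
split; apply/ler_addgt0Pr => e e0.
  have [d d0 Hd] := HX t w _ e0; pose u := d / 2.
  have u0 : 0 < `|u| by rewrite gtr0_norm /u; lra.
  have ud : 0 < `|u| < d by rewrite u0 gtr0_norm /u; lra.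
  rewrite -[V t w](subKr ((u^-1)%:C%C * (field_op (G (t + u)) f w - field_op (G t) f w))).
  by apply: le_trans (cabsB _ _) (lerD _ (Hd u ud)); apply: quot.
have e20 : 0 < e / 2 by lra.
have [d d0 Hd] := HX t w _ e20.
have [d' d'0 Hd'] := HX s w _ e20.
(* One increment admissible at both [t] and [s], so that the two quotients combine into a second
   difference. *)
pose u := Num.min d d' / 2; have m0 : 0 < Num.min d d' by rewrite lt_min d0.
have uE : `|u| = u by rewrite gtr0_norm // /u; lra.
have u0 : 0 < `|u| by rewrite uE /u; lra.
have um : `|u| < Num.min d d' by rewrite uE /u; lra.
have [ud ud'] : `|u| < d /\ `|u| < d' by apply/andP; rewrite -lt_min.
have {}Hd : cabs _ <= e / 2 := Hd u (introT andP (conj u0 ud)).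
have {}Hd' : cabs _ <= e / 2 := Hd' u (introT andP (conj u0 ud')).
move: Hd Hd'; set X := field_op (G (t + u)) f w - _.
set Y := field_op (G (s + u)) f w - _ => Hd Hd'.
have -> : V t w - V s w = (u^-1)%:C%C * (X - Y) -
   (((u^-1)%:C%C * X - V t w) - ((u^-1)%:C%C * Y - V s w)) by ring.
apply: le_trans (cabsB _ _) (lerD _ _).
  by apply: quot => //; rewrite mulrA; exact: Xdiff2_le.
by apply: le_trans (cabsB _ _) _; apply: le_trans (lerD Hd Hd') _; lra.
Qed.

Lemma is_Wm_bounds (m : R -> R) (W : R -> fock R -> fock R) f :
  measurable_fun [set: R] m -> (forall u, 0 <= m u) ->
  (\int[@lebesgue_measure R]_(u in [set: R]) (m u / (1 + u ^+ 2))%:E < +oo)%E ->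
  is_Wm m W -> inS1 f ->
  exists2 B : R, 0 <= B & forall t s w,
    cabs (W t f w) <= B * word_size R w ^+ 4 /\
    cabs (W t f w - W s f w) <= `|t - s| * (B * word_size R w ^+ 4).
Proof.
move=> m_meas m_ge0 m_int HW fS.
have [L L0 HL] := gcoef_bounds m_meas m_ge0 m_int.
exact: (@field_op_derivative_bounds (gcoef m) (fun t => W t f) f L L0 fS HL
  (is_Wm_coord HW fS)).
Qed.

End Derivative.

(** * Riemann sums *)

Section RiemannSums.
Variable R : realType.
Implicit Types (phi : R -> R) (z : R -> R[i]) (a b : R).

(** Otherwise pairs ever closer together keep values more than [e] apart, and continuity fails at a
    cluster point of their first components. *)
Lemma uniform_continuity_segment phi a b : continuous phi ->
  forall e : R, 0 < e -> exists2 d : R, 0 < d &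
    forall x y, a <= x <= b -> a <= y <= b -> `|x - y| < d -> `|phi x - phi y| <= e.
Proof.
move=> cphi e e0; apply: contrapT => nu.
have bad (n : nat) : exists xy : R * R, [/\ a <= xy.1 <= b,
    `|xy.1 - xy.2| < n.+1%:R^-1 & e < `|phi xy.1 - phi xy.2|].
  apply: contrapT => nn; apply: nu; exists n.+1%:R^-1; first by rewrite invr_gt0.
  move=> x y xab yab xy; rewrite leNgt; apply/negP => lt.
  by apply: nn; exists (x, y).
have [xy xyP] := choice bad.
have [|z _ zc] := @segment_cluster R (fun n => (xy n).1) a b.
  by move=> q; have [] := xyP q.
have /cvgrPdist_le /(_ (e / 2)) : phi x @[x --> z] --> phi z := cphi z.
case; first by lra.
move=> d /= d0 Hd; have d20 : 0 < d / 2 by lra.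
have [n Nn xz] := zc (d / 2) d20 (Num.bound (d / 2)^-1).
have [_ xyn lt] := xyP n; rewrite /= in xz.
have n1 : n.+1%:R^-1 < d / 2.
  rewrite invf_plt ?posrE //; apply: lt_le_trans (_ : (Num.bound (d / 2)^-1)%:R <= _).
    by apply: archi_boundP; rewrite invr_ge0 ltW.
  by rewrite ler_nat (leq_trans Nn).
have h1 : `|phi z - phi (xy n).1| <= e / 2.
  by apply: Hd; rewrite /= distrC; lra.
have h2 : `|phi z - phi (xy n).2| <= e / 2.
  apply: Hd => /=.
  rewrite (_ : z - (xy n).2 = ((xy n).1 - (xy n).2) - ((xy n).1 - z)); last by ring.
  by apply: le_lt_trans (ler_normB _ _) _; rewrite (splitr d) ltrD // (lt_trans xyn).
have : `|phi (xy n).1 - phi (xy n).2| <= e.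
  rewrite (_ : _ - _ = (phi z - phi (xy n).2) - (phi z - phi (xy n).1)); last by ring.
  by apply: le_trans (ler_normB _ _) _; lra.
by rewrite leNgt lt.
Qed.

Lemma is_derive_derive1 phi (x l : R) : derivable phi x 1 -> derive1 phi x = l ->
  is_derive x 1 phi l.
Proof. by move=> dphi phiE; apply: DeriveDef; rewrite // -derive1E. Qed.

(** Integration starts at [a - 1], which makes [a] an interior point and gives a two-sided
    derivative there too. *)
Lemma antiderivative phi a : continuous phi ->
  exists F : R -> R, forall x, a <= x -> is_derive x 1 F (phi x).
Proof.
move=> cphi.
exists (fun x => \int[@lebesgue_measure R]_(t in `[a - 1, x]) phi t)%R => x ax.
have [||||dF F'] := @continuous_FTC1_closed R phi (a - 1) x (x + 1).
- by rewrite ltrDl.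
- apply: continuous_compact_integrable; first exact: segment_compact.
  by apply: continuous_in_subspaceT => y _; exact: cphi.
- by lra.
- exact: cphi.
exact: is_derive_derive1 dF F'.
Qed.

(** Monotonicity of the nodes is not listed; it follows from the tags lying between consecutive
    nodes. *)
Definition tagged_partition a b (d : R) (n : nat) (x s : nat -> R) :=
  [/\ x 0%N = a, x n = b &
    forall i, (i < n)%N -> x i <= s i <= x i.+1 /\ x i.+1 - x i < d].

Lemma tagged_partition_itv a b d n x s : tagged_partition a b d n x s ->
  forall i, (i < n)%N -> a <= x i /\ x i.+1 <= b.
Proof.
move=> [<- <- xs].
have mono i : (i < n)%N -> x i <= x i.+1.
  by move=> /xs [/andP[h1 h2] _]; exact: le_trans h1 h2.
have up i : (i <= n)%N -> x 0%N <= x i.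
  elim: i => // i IH lin; apply: le_trans (IH (ltnW lin)) (mono _ lin).
have down i : (i <= n)%N -> x (n - i)%N <= x n.
  elim: i => [|i IH] lin; first by rewrite subn0.
  apply: le_trans (IH (ltnW lin)).
  by rewrite -(subnSK lin); apply: mono; rewrite subnSK // leq_subr.
move=> i lin; split; first exact/up/ltnW.
by have := down (n - i.+1)%N (leq_subr _ _); rewrite subKn.
Qed.

Lemma tagged_partition_tag a b d n x s : tagged_partition a b d n x s ->
  forall i, (i < n)%N -> [/\ a <= s i <= b, 0 <= x i.+1 - x i & x i.+1 - x i < d].
Proof.
move=> p i lin; have [h1 h2] := tagged_partition_itv p lin.
have [_ _ /(_ i lin) [/andP[h3 h4] h5]] := p.
by split=> //; [apply/andP; split|]; lra.
Qed.

Lemma sum_increments a b d n x s : tagged_partition a b d n x s ->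
  \sum_(i < n) (x i.+1 - x i) = b - a.
Proof.
by move=> [<- <- _]; rewrite -(big_mkord xpredT (fun i => x i.+1 - x i)) telescope_sumr.
Qed.

(* By the mean value theorem, F b - F a is itself a tagged sum of phi. *)
Lemma Riemann_sums_cvg phi a b (M : R) : a <= b -> continuous phi ->
  (forall t, a <= t <= b -> `|phi t| <= M) ->
  exists2 I : R, `|I| <= M * (b - a) &
    forall e : R, 0 < e -> exists2 d : R, 0 < d & forall n x s,
      tagged_partition a b d n x s ->
      `|\sum_(i < n) (x i.+1 - x i) * phi (s i) - I| <= e.
Proof.
move=> ab cphi phiM; have [F dF] := antiderivative a cphi.
have mvt x y : a <= x -> x <= y ->
    exists2 c, x <= c <= y & F y - F x = phi c * (y - x).
  move=> ax xy; have [||c] := @MVT_segment R F phi x y xy.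
  - by move=> u; rewrite in_itv /= => /andP[xu _]; apply: dF; lra.
  - apply: derivable_within_continuous => u; rewrite in_itv /= => /andP[xu _].
    have au : a <= u by lra.
    by have := dF u au; case.
  by rewrite in_itv /= => xcy E; exists c.
exists (F b - F a).
  have [c cab ->] := mvt a b (lexx a) ab.
  by rewrite normrM [`|b - a|]ger0_norm ?subr_ge0 // ler_wpM2r ?subr_ge0 ?phiM.
(* The summand 1 keeps the quotient meaningful when a = b. *)
move=> e e0; have e1 : 0 < e / (b - a + 1) by rewrite divr_gt0 //; lra.
have [d d0 Hd] := @uniform_continuity_segment phi a b cphi _ e1.
exists d => // n x s p.
have FE : \sum_(i < n) (F (x i.+1) - F (x i)) = F b - F a.
  by case: p => <- <- _; rewrite -(big_mkord xpredT (fun i => F (x i.+1) - F (x i)))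
    telescope_sumr.
rewrite -FE -sumrB; apply: le_trans (ler_norm_sum _ _ _) _.
apply: (@le_trans _ _ (\sum_(i < n) (x i.+1 - x i) * (e / (b - a + 1)))).
  apply: ler_sum => i _; have lin := ltn_ord i.
  have [ax xb] := tagged_partition_itv p lin.
  have [sab x0 xd] := tagged_partition_tag p lin.
  have [_ _ /(_ i lin) [/andP[xs sx] _]] := p.
  have [|c /andP[xc cx] ->] := mvt (x i) (x i.+1) ax; first by lra.
  rewrite mulrC -mulrBl normrM (ger0_norm x0) mulrC ler_wpM2l //.
  apply: Hd => //; first by apply/andP; split; lra.
  by rewrite ltr_norml; lra.
rewrite -mulr_suml (sum_increments p) mulrCA ler_piMr ?(ltW e0) //.
by rewrite ler_pdivrMr; lra.
Qed.

Definition complex_continuous z :=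
  continuous (fun t => cre (z t)) /\ continuous (fun t => cim (z t)).

Lemma complex_continuous_sum n (z : nat -> R -> R[i]) :
  (forall i, complex_continuous (z i)) ->
  complex_continuous (fun t => \sum_(i < n) z i t).
Proof.
move=> zc; elim: n => [|n [IHr IHi]]; split.
- rewrite (_ : (fun t => _) = fun=> 0); first exact: cst_continuous.
  by apply/funext => t; rewrite big_ord0.
- rewrite (_ : (fun t => _) = fun=> 0); first exact: cst_continuous.
  by apply/funext => t; rewrite big_ord0.
- rewrite (_ : (fun t => _) = fun t => cre (\sum_(i < n) z i t) + cre (z n t)).
    by move=> t; exact: cvgD (IHr t) ((zc n).1 t).
  by apply/funext => t; rewrite big_ord_recr creD.
- rewrite (_ : (fun t => _) = fun t => cim (\sum_(i < n) z i t) + cim (z n t)).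
    by move=> t; exact: cvgD (IHi t) ((zc n).2 t).
  by apply/funext => t; rewrite big_ord_recr cimD.
Qed.

Lemma complex_continuousM y z : complex_continuous y -> complex_continuous z ->
  complex_continuous (fun t => y t * z t).
Proof.
move=> [yr yi] [zr zi]; split.
  rewrite (_ : (fun t => _) = fun t => cre (y t) * cre (z t) - cim (y t) * cim (z t)).
    move=> t; apply: cvgB; first exact: cvgM (yr t) (zr t).
    exact: cvgM (yi t) (zi t).
  by apply/funext => t; rewrite creM.
rewrite (_ : (fun t => _) = fun t => cre (y t) * cim (z t) + cim (y t) * cre (z t)).
  move=> t; apply: cvgD; first exact: cvgM (yr t) (zi t).
  exact: cvgM (yi t) (zr t).
by apply/funext => t; rewrite cimM.
Qed.

Lemma complex_continuousP z :
  (forall (t e : R), 0 < e -> exists2 d : R, 0 < d &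
     forall s, `|s - t| < d -> cabs (z s - z t) <= e) -> complex_continuous z.
Proof.
move=> zc; split=> t; apply/cvgrPdist_le => e e0; have [d d0 Hd] := zc t e e0;
  exists d => // s /=; rewrite distrC => /Hd st; rewrite distrC.
  by rewrite -creB; exact: le_trans (cre_le_cabs _) st.
by rewrite -cimB; exact: le_trans (cim_le_cabs _) st.
Qed.

Lemma complex_Riemann_sums_cvg z a b (M : R) : a <= b -> complex_continuous z ->
  (forall t, a <= t <= b -> cabs (z t) <= M) ->
  exists2 I : R[i], cabs I <= 2 * M * (b - a) &
    forall e : R, 0 < e -> exists2 d : R, 0 < d & forall n x s,
      tagged_partition a b d n x s ->
      cabs (\sum_(i < n) (x i.+1 - x i)%:C%C * z (s i) - I) <= e.
Proof.
move=> ab [zr zi] zM.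
have [Ir IrM Hr] := @Riemann_sums_cvg (fun t => cre (z t)) a b M ab zr
  (fun t tab => le_trans (cre_le_cabs _) (zM t tab)).
have [Ii IiM Hi] := @Riemann_sums_cvg (fun t => cim (z t)) a b M ab zi
  (fun t tab => le_trans (cim_le_cabs _) (zM t tab)).
exists (Ir +i* Ii)%C.
  by apply: le_trans (cabs_le_re_im _) _ => /=; lra.
move=> e e0; have e20 : 0 < e / 2 by lra.
have [d d0 Hd] := Hr _ e20; have [d' d'0 Hd'] := Hi _ e20.
exists (Num.min d d') => [|n x s [xa xb xs]]; first by rewrite lt_min d0.
have p d1 : Num.min d d' <= d1 -> tagged_partition a b d1 n x s.
  move=> le; split=> // i lin; have [h1 h2] := xs i lin; split=> //.
  exact: lt_le_trans h2 le.
have le1 : Num.min d d' <= d by rewrite ge_min lexx.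
have le2 : Num.min d d' <= d' by rewrite ge_min lexx orbT.
have {}Hd := Hd n x s (p d le1); have {}Hd' := Hd' n x s (p d' le2).
apply: le_trans (cabs_le_re_im _) _; rewrite creB cimB cre_sum cim_sum /=.
have -> : \sum_(i < n) cre ((x i.+1 - x i)%:C%C * z (s i)) =
    \sum_(i < n) (x i.+1 - x i) * cre (z (s i)).
  by apply: eq_bigr => i _; rewrite creM /= mul0r subr0.
have -> : \sum_(i < n) cim ((x i.+1 - x i)%:C%C * z (s i)) =
    \sum_(i < n) (x i.+1 - x i) * cim (z (s i)).
  by apply: eq_bigr => i _; rewrite cimM /= mul0r addr0.
by lra.
Qed.

End RiemannSums.

(** * Coefficient bounds for the tensor product and convergence in norm *)

Section TensorIntegral.
Variable R : realType.
Implicit Types (w : seq nat) (f F G : fock R) (Y : R -> fock R) (a b t : R).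

(** Composition with this 1-Lipschitz retraction extends a function from [a, b] to the line, where
    the continuity required by the Riemann sum lemmas is stated. *)
Definition clamp a b t := Num.max a (Num.min b t).

Lemma clamp_id a b t : a <= t <= b -> clamp a b t = t.
Proof. by move=> /andP[at_ tb]; rewrite /clamp min_r // max_r. Qed.

Lemma clamp_itv a b t : a <= b -> a <= clamp a b t <= b.
Proof. by move=> ab; rewrite /clamp le_max lexx /= ge_max ab ge_min lexx. Qed.

Lemma clamp_lipschitz a b t s : `|clamp a b s - clamp a b t| <= `|s - t|.
Proof.
have h1 := ler_norm (s - t); have h2 := ler_norm (t - s); rewrite distrC in h2.
rewrite /clamp; case: (leP b s) => ?; case: (leP b t) => ?; case: (leP a b) => ?;
  case: (leP a s) => ?; case: (leP a t) => ?; rewrite ler_norml; apply/andP; split; lra.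
Qed.

(** [word_size] is multiplicative across a cut, so each term has exponent at most p + q; the number
    of cuts is at most [word_size], which adds one. *)
Lemma ftensor_bound F G (M M' : R) (p q : nat) : 0 <= M -> 0 <= M' ->
  (forall w, cabs (F w) <= M * word_size R w ^+ p) ->
  (forall w, cabs (G w) <= M' * word_size R w ^+ q) ->
  forall w, cabs (ftensor F G w) <= M * M' * word_size R w ^+ (p + q).+1.
Proof.
move=> M0 M'0 FM GM w; apply: le_trans (cabs_sum _ _) _.
apply: (@le_trans _ _ (\sum_(i < (size w).+1) M * M' * word_size R w ^+ (p + q))).
  apply: ler_sum => i _; rewrite cabsM.
  apply: le_trans (ler_pM (cabs_ge0 _) (cabs_ge0 _) (FM _) (GM _)) _.
  rewrite mulrACA ler_wpM2l ?mulr_ge0 //.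
  rewrite -[in leRHS](cat_take_drop i w) word_size_cat exprMn.
  have w1 := word_size_ge1 R (take i w); have w2 := word_size_ge1 R (drop i w).
  by rewrite ler_pM ?exprn_ge0 ?ler_weXn2l ?leq_addr ?leq_addl // (le_trans ler01).
rewrite sumr_const card_ord -mulr_natl exprS mulrCA ler_wpM2l ?mulr_ge0 //.
rewrite ler_wpM2r ?word_size_ge_size //.
by rewrite exprn_ge0 // ltW // word_size_gt0.
Qed.

(** Of the three extra powers, two are kept for summation over words and one remains as the factor 1
    / [word_size], which controls the tail. *)
Lemma weighted_bound F (M : R) (q : nat) w : 0 <= M ->
  cabs (F w) <= M * word_size R w ^+ q ->
  cabs2 (F w) * weight R (- (2 * q + 3)%N%:Z) w <=
    M ^+ 2 / word_size R w * word_size R w ^- 2.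
Proof.
move=> M0 FM; have w0 := word_size_gt0 R w.
rewrite weight_neg ler_pdivrMr ?exprn_gt0 //.
have wq := exprn_gt0 q w0.
rewrite exprD mulnC exprM [leRHS](_ : _ = (M * word_size R w ^+ q) ^+ 2).
  by rewrite -cabs_le_sqr // mulr_ge0 // ltW.
set z := word_size R w in w0 wq *; set y := z ^+ q in wq *.
by field; rewrite gt_eqF.
Qed.

Lemma inGamma_of_bound F (M : R) (q : nat) : 0 <= M ->
  (forall w, cabs (F w) <= M * word_size R w ^+ q) ->
  inGamma (- (2 * q + 3)%N%:Z) F.
Proof.
move=> M0 FM; rewrite /inGamma.
apply: le_lt_trans (_ : _ <= (2 * M ^+ 2)%:E)%E _; last exact: ltry.
apply: fnorm2_le => [|w]; first exact: sqr_ge0.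
apply: le_trans (weighted_bound M0 (FM w)) _.
have w1 := word_size_ge1 R w; have w0 := word_size_gt0 R w.
rewrite ler_wpM2r ?invr_ge0 ?exprn_ge0 ?(ltW w0) //.
by rewrite ler_piMr ?sqr_ge0 // invf_le1.
Qed.

(* Words of large [word_size] are negligible by the uniform bound; only finitely
   many words remain. *)
Lemma fnorm2_small_of_coord (K : R) (q : nat) (eps : R) : 0 <= K -> 0 < eps ->
  exists (s : seq (seq nat)) (e : R), 0 < e /\ forall G,
    (forall w, cabs (G w) <= K * word_size R w ^+ q) ->
    (forall w, w \in s -> cabs (G w) <= e) ->
    (fnorm2 (- (2 * q + 3)%N%:Z) G < eps%:E)%E.
Proof.
move=> K0 eps0; pose eta := eps / 4; have eta0 : 0 < eta by rewrite /eta; lra.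
(* Beyond size [N] the spare factor 1 / [word_size] brings K ^+ 2 / [word_size] below [eta]. *)
pose N := (Num.bound (K ^+ 2 / eta)).+1.
exists (words N N), (Num.sqrt eta); split=> [|G GK Ge]; first by rewrite sqrtr_gt0.
have KN : K ^+ 2 / eta <= N%:R.
  apply: (@le_trans _ _ (Num.bound (K ^+ 2 / eta))%:R); last by rewrite ler_nat.
  by apply/ltW/archi_boundP; rewrite divr_ge0 ?sqr_ge0 // ltW.
apply: (@le_lt_trans _ _ (2 * eta)%:E); last by rewrite lte_fin /eta; lra.
apply: fnorm2_le => [|w]; first exact: ltW.
have w1 := word_size_ge1 R w; have w0 := word_size_gt0 R w.
have w20 : 0 <= word_size R w ^- 2 by rewrite invr_ge0 exprn_ge0 // ltW.
have [wN|Nw] := leP (word_size R w) N%:R; last first.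
  apply: le_trans (weighted_bound K0 (GK w)) _; rewrite ler_wpM2r //.
  rewrite ler_pdivrMr // mulrC -ler_pdivrMr //.
  exact: le_trans KN (ltW Nw).
(* Size at most [N] forces both the length and all letters below [N]. *)
have ws : w \in words N N.
  apply: mem_words => [|k kw].
    by rewrite -(ler_nat R); apply: le_trans wN; apply: le_trans (word_size_ge_size R w);
      rewrite ler_nat.
  by rewrite -(ler_nat R); exact: le_trans (letter_le_word_size R kw) wN.
have := Ge w ws; rewrite cabs_le_sqr ?sqrtr_ge0 // sqr_sqrtr ?(ltW eta0) // => Gw.
rewrite weight_neg ler_pM ?cabs2_ge0 //.
  by rewrite invr_ge0 exprn_ge0 // ltW.
by rewrite lef_pV2 ?posrE ?exprn_gt0 // ler_weXn2l // addn3 ltnS ltnW.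
Qed.

Lemma uniform_delta (T : eqType) (P : T -> R -> Prop) (s : seq T) :
  (forall x d d', P x d -> d' <= d -> P x d') ->
  (forall x, exists2 d, 0 < d & P x d) ->
  exists2 d, 0 < d & forall x, x \in s -> P x d.
Proof.
move=> Pmono Pd; elim: s => [|y s [d d0 IH]]; first by exists 1.
have [d' d'0 Py] := Pd y; exists (Num.min d d'); first by rewrite lt_min d0.
move=> x; rewrite inE => /orP[/eqP ->|/IH Px].
  by apply: Pmono Py _; rewrite ge_min lexx orbT.
by apply: Pmono Px _; rewrite ge_min lexx.
Qed.

(** Each coordinate of the integrand is a finite sum of products of continuous functions. The
    integral is assembled from its coordinates by choice, and the bound on each coordinate integral
    places it in the same space. *)
Lemma ftensor_integral Y (W : R -> fock R -> fock R) f a b (M B : R)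
    (p q : nat) : a <= b ->
  0 <= M -> 0 <= B ->
  (forall t, a <= t <= b -> forall w, cabs (Y t w) <= M * word_size R w ^+ p) ->
  (forall w t, a <= t <= b -> forall e, 0 < e -> exists2 d, 0 < d &
     forall s, a <= s <= b -> `|s - t| < d -> cabs (Y s w - Y t w) <= e) ->
  (forall t s w, cabs (W t f w) <= B * word_size R w ^+ q /\
     cabs (W t f w - W s f w) <= `|t - s| * (B * word_size R w ^+ q)) ->
  exists r : nat,
    (forall t, a <= t <= b -> inGamma (- r%:Z) (ftensor (Y t) (W t f))) /\
    exists2 I : fock R, inGamma (- r%:Z) I &
      forall eps : R, 0 < eps -> exists2 d : R, 0 < d & forall n x s,
        tagged_partition a b d n x s ->
        (fnorm2 (- r%:Z) (fsub (riemann_sum Y W f n x s) I) < eps%:E)%E.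
Proof.
move=> ab M0 B0 YM Yc WB; pose Q := (p + q).+1; pose K := M * B.
have K0 : 0 <= K by rewrite mulr_ge0.
exists (2 * Q + 3)%N.
have psiK t : a <= t <= b -> forall w,
    cabs (ftensor (Y t) (W t f) w) <= K * word_size R w ^+ Q.
  move=> tab; apply: ftensor_bound => //; first exact: YM.
  by move=> w; have [] := WB t t w.
split=> [t tab|]; first exact: inGamma_of_bound (psiK t tab).
pose cl := clamp a b; have clab t : a <= cl t <= b by exact: clamp_itv.
pose psi w t := ftensor (Y (cl t)) (W (cl t) f) w.
have psi_cont w : complex_continuous (psi w).
  apply: (@complex_continuous_sum R (size w).+1
    (fun i t => Y (cl t) (take i w) * W (cl t) f (drop i w))) => i.
  apply: complex_continuousM.
    apply: complex_continuousP => t e e0; set v := take i w.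
    have [d d0 Hd] := Yc v (cl t) (clab t) e e0; exists d => // s st.
    by apply: Hd => //; exact: le_lt_trans (clamp_lipschitz _ _ _ _) st.
  apply: complex_continuousP => t e e0; set v := drop i w.
  have C1 : 0 < B * word_size R v ^+ q + 1.
    by rewrite ltr_wpDl // mulr_ge0 // exprn_ge0 // ltW // word_size_gt0.
  exists (e / (B * word_size R v ^+ q + 1)) => [|s st]; first exact: divr_gt0.
  have [_ h] := WB (cl s) (cl t) v; apply: le_trans h _.
  move: st; rewrite ltr_pdivlMr // => st; apply: le_trans (ltW st).
  apply: ler_pM => //; first by rewrite mulr_ge0 // exprn_ge0 // ltW // word_size_gt0.
    exact: clamp_lipschitz.
  by rewrite lerDl.
have psiE w t : a <= t <= b -> psi w t = ftensor (Y t) (W t f) w.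
  by move=> tab; rewrite /psi /cl clamp_id.
have Iw w : exists J : R[i], cabs J <= 2 * (K * word_size R w ^+ Q) * (b - a) /\
    forall e, 0 < e -> exists2 d, 0 < d & forall n x s, tagged_partition a b d n x s ->
      cabs (\sum_(i < n) (x i.+1 - x i)%:C%C * psi w (s i) - J) <= e.
  have [J J1 J2] := @complex_Riemann_sums_cvg R (psi w) a b (K * word_size R w ^+ Q) ab
    (psi_cont w) (fun t tab => psiK (cl t) (clab t) w).
  by exists J.
have [I IP] := choice Iw.
have ba : 0 <= b - a by rewrite subr_ge0.
pose KI := 2 * K * (b - a); have KI0 : 0 <= KI by rewrite !mulr_ge0.
have IK w : cabs (I w) <= KI * word_size R w ^+ Q.
  have [h _] := IP w; apply: le_trans h _.
  by rewrite [leLHS](_ : _ = KI * word_size R w ^+ Q) // /KI; ring.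
exists I; first exact: inGamma_of_bound IK.
move=> eps eps0; pose KS := K * (b - a).
have KS0 : 0 <= KS by rewrite mulr_ge0.
(* [KS] bounds every Riemann sum and [KI] the integral, whatever the partition; only the finitely
   many words of [ws] then constrain the mesh. *)
have [ws [e [e0 small]]] :=
  @fnorm2_small_of_coord (KS + KI) Q eps (addr_ge0 KS0 KI0) eps0.
have [|w|d d0 Hd] := @uniform_delta _ (fun w d => forall n x s,
    tagged_partition a b d n x s ->
    cabs (\sum_(i < n) (x i.+1 - x i)%:C%C * psi w (s i) - I w) <= e) ws.
- move=> w d d' H d'd n x s [xa xb xs]; apply: H; split=> // i lin.
  by have [h1 h2] := xs i lin; split=> //; exact: lt_le_trans h2 d'd.
- by have [_ H] := IP w; have [d d0 Hd] := H e e0; exists d.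
exists d => // n x s xs.
have sumE w : fsub (riemann_sum Y W f n x s) I w =
    \sum_(i < n) (x i.+1 - x i)%:C%C * psi w (s i) - I w.
  rewrite /fsub; congr (_ - _); apply: eq_bigr => i _; rewrite psiE //.
  by have [] := tagged_partition_tag xs (ltn_ord i).
apply: small => [w|w wws]; last by rewrite sumE; exact: Hd wws n x s xs.
rewrite mulrDl; apply: le_trans (cabsB _ _) (lerD _ (IK w)).
apply: le_trans (cabs_sum _ _) _.
apply: (@le_trans _ _ (\sum_(i < n) (x i.+1 - x i) * (K * word_size R w ^+ Q))).
  apply: ler_sum => i _; have [sab x0 _] := tagged_partition_tag xs (ltn_ord i).
  by rewrite cabsM cabs_real ger0_norm // ler_wpM2l // psiK.
rewrite -mulr_suml (sum_increments xs).
by rewrite [leLHS](_ : _ = KS * word_size R w ^+ Q) // /KS; ring.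
Qed.

End TensorIntegral.

Unset Implicit Arguments.

Theorem theorem7p6 (R : realType) (m : R -> R) (beta : R) (N : nat) (K : R)
  (m_meas : measurable_fun [set: R] m)
  (m_ge0 : forall u, 0 <= m u)
  (m_int : (\int[@lebesgue_measure R]_(u in [set: R]) (m u / (1 + u ^+ 2))%:E
             < +oo)%E)
  (beta_lt2 : beta < 2)
  (m_small : forall u : R, 0 < `|u| <= 1 -> m u <= K * powR `|u| (- beta))
  (m_large : forall u : R, 1 < `|u| -> m u <= K * `|u| ^+ (2 * N))
  (W : R -> fock R -> fock R) (HW : is_Wm m W)
  (f : fock R) (hf : inS1 f)
  (a b : R) (hab : a <= b)
  (Y : R -> fock R) (HY : Sm1_continuous_on Y a b) :
  exists p : nat,
    (forall t, a <= t <= b -> inGamma (- p%:Z) (ftensor (Y t) (W t f))) /\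
    exists2 I : fock R, inGamma (- p%:Z) I &
      forall eps : R, 0 < eps -> exists2 d : R, 0 < d &
        forall (n : nat) (x s : nat -> R),
          x 0%N = a -> x n = b ->
          (forall i, (i < n)%N -> x i <= s i <= x i.+1 /\ x i.+1 - x i < d) ->
          (fnorm2 (- p%:Z) (fsub (riemann_sum Y W f n x s) I) < eps%:E)%E.
Proof.
have [B B0 WB] := is_Wm_bounds m_meas m_ge0 m_int HW hf.
have [M [q [M0 YM]]] := Sm1_continuous_bounded HY.
have [p [Yp [I Ip cvg]]] := ftensor_integral hab M0 B0 YM
  (fun w => Sm1_continuous_coord w HY) WB.
exists p; split=> //; exists I => // eps eps0.
have [d d0 Hd] := cvg eps eps0; exists d => // n x s xa xb xs.
by apply: Hd; split.
Qed.
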